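(* Let $n\ge1$. For every integer $j$ with $0\le j<n/2$, $$C^{[2]}_{(n),(n-j,j)}(t)=t^j(1+t)[n-2j]_t,\qquad [r]_t=1+t+\cdots+t^{r-1},$$ where for $j=0$ the partition $(n,0)$ means $(n)$. If $\mu\in\mathrm{SP}(n)$ has length greater than two, then $C^{[2]}_{(n),\mu}(t)=0$. Thus $$Q_{(n)}[X+tX]=\sum_{0\le j<n/2}t^j(1+t)[n-2j]_t\,Q_{(n-j,j)}(X),$$ where $Q_{(n,0)}=Q_{(n)}$.
   Context: A strict partition is a finite sequence $\lambda=(\lambda_1>\cdots>\lambda_\ell>0)$ of integers, with $|\lambda|=\sum\lambda_i$ and length $\ell(\lambda)=\ell$; $\mathrm{SP}(N)$ is the set of strict partitions of $N$. Let $\Gamma=\mathbb{Q}[p_1,p_3,p_5,\ldots]$ be the ring of odd power sums, graded by $\deg p_n=n$, with degree-$N$ component $\Gamma_N$. The Schur $Q$-functions $Q_\lambda\in\Gamma$ are defined as follows: $q_r$ is given by $\sum_{r\ge0}q_rz^r=\exp\bigl(2\sum_{n\ge1,\ n\text{ odd}}\frac{p_n}{n}z^n\bigr)$; for $r\ge s\ge0$ let $Q_{(r,s)}=q_rq_s+2\sum_{k=1}^{s}(-1)^kq_{r+k}q_{s-k}$; in general $Q_\lambda$ is the Pfaffian of the antisymmetric matrix with entries $Q_{(\lambda_i,\lambda_j)}$ for $i<j$, where a zero part is appended to $\lambda$ if $\ell(\lambda)$ is odd (so $Q_{(r)}=q_r$, $Q_\varnothing=1$). $\{Q_\lambda:\lambda\in\mathrm{SP}(N)\}$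 is a basis of $\Gamma_N$. For indeterminates $t,s$, let $T_{t,s}$ be the algebra automorphism of $\Gamma$ (scalars extended to $\mathbb{Q}(t,s)$) with $T_{t,s}(p_n)=\frac{1-t^n}{1-s^n}p_n$ for $n$ odd, and define $C_{\lambda\mu}(t,s)$, $\lambda,\mu\in\mathrm{SP}(N)$, by $T_{t,s}Q_\lambda=\sum_{\mu\in\mathrm{SP}(N)}C_{\lambda\mu}(t,s)Q_\mu$. Set $C^{[2]}_{\lambda\mu}(t):=C_{\lambda\mu}(t^2,t)$. Equivalently, $Q_\lambda[X+tX]=\sum_{\mu}C^{[2]}_{\lambda\mu}(t)Q_\mu(X)$, where $f[X+tX]$ is the image of $f\in\Gamma$ under the algebra map $p_n\mapsto(1+t^n)p_n$ ($n$ odd). *)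

(* Defs.v *)
From HB Require Import structures.
From Stdlib Require Import ClassicalEpsilon.
From mathcomp Require Import all_boot all_order all_fingroup all_algebra.
From mathcomp Require Import finmap.
From mathcomp Require Import monalg.

Set Implicit Arguments.
Unset Strict Implicit.
Unset Printing Implicit Defensive.

Import GRing.Theory.
Local Open Scope ring_scope.

Definition is_strict_partition (N : nat) (la : seq nat) : bool :=
  [&& sorted gtn la, all (leq 1) la & sumn la == N].

(* [SP_le m N] lists the strict partitions of [N] all of whose parts are at
   most [m]: either [m] is a part, or all parts are at most [m - 1]. *)
Fixpoint SP_le (m N : nat) : seq (seq nat) :=
  if m is m'.+1 then
    (if (m <= N)%N then [seq m :: la | la <- SP_le m' (N - m)] else [::])
      ++ SP_le m' N
  else if N == 0 then [:: [::]] else [::].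

Definition SP (N : nat) : seq (seq nat) := SP_le N N.

Lemma mem_SP_le m N la :
  (la \in SP_le m N) = is_strict_partition N la && all (fun x => x <= m)%N la.
Proof.
rewrite /is_strict_partition.
elim: m N la => [|m IH] N la /=.
  case: la => [|x la] /=; first by case: N.
  have -> : (x :: la \in (if N == 0 then [:: [::]] else [::])) = false.
    by case: eqP.
  symmetry; apply/negbTE/negP => /andP[/and3P[_ /andP[x1 _] _] /andP[x0 _]].
  by move: (leq_trans x1 x0).
rewrite mem_cat IH.
have Hcons la' : m.+1 :: la' \in
    (if (m < N)%N then [seq m.+1 :: la0 | la0 <- SP_le m (N - m.+1)] else [::])
  = (m < N)%N && (la' \in SP_le m (N - m.+1)).
  by case: ifP => // _; rewrite mem_map // => a b [].
have Hin : la \in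
    (if (m < N)%N then [seq m.+1 :: la0 | la0 <- SP_le m (N - m.+1)] else [::])
  -> exists la', la = m.+1 :: la'.
  by case: ifP => // _ /mapP[la' _ ->]; exists la'.
case: la Hin => [|x la] Hin /=.
  rewrite !andbT orbC; case: eqP => //= _.
  by apply/negbTE/negP => /Hin[].
case: (ltngtP x m.+1) => [ltxm|gtxm|eqxm].
- have -> : (x :: la \in (if (m < N)%N then
      [seq m.+1 :: la0 | la0 <- SP_le m (N - m.+1)] else [::])) = false.
    by apply/negbTE/negP => /Hin[la' [E _]]; rewrite E ltnn in ltxm.
  rewrite /= -[(x <= m)%N]/(x < m.+1)%N ltxm /=.
  have H : path gtn x la -> all (fun y => y <= m)%N la /\
                            all (fun y => y <= m.+1)%N la.
    move=> px; have /allP ax : all (gtn x) la.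
      by apply: order_path_min px => a b c /= ab /ltn_trans; apply.
    split; apply/allP => y /ax /= yx.
      by rewrite -ltnS (leq_trans yx) // ltnW.
    by rewrite ltnW // (leq_trans yx) // ltnW.
  by case px: (path gtn x la) => //=; have [-> ->] := H px.
- have -> : (x :: la \in (if (m < N)%N then
      [seq m.+1 :: la0 | la0 <- SP_le m (N - m.+1)] else [::])) = false.
    by apply/negbTE/negP => /Hin[la' [E _]]; rewrite E ltnn in gtxm.
  by rewrite /= (leqNgt x m) (ltnW gtxm) /= !andbF.
subst x; rewrite Hcons IH /= ltnn /= !andbF orbF.
case: (ltnP m N) => [ltmN|leNm] /=; last first.
  case: eqP => [E|_]; last by rewrite !andbF.
  by move: leNm; rewrite -E addSn ltnNge leq_addr.
have -> : (sumn la == N - m.+1)%N = (m.+1 + sumn la == N)%N.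
  by rewrite -(eqn_add2l m.+1) subnKC.
case px: (path gtn m.+1 la) => /=; last first.
  apply/negbTE/negP => /andP[/and3P[sla _ _] ala].
  suff: path gtn m.+1 la by rewrite px.
  case: la sla ala {px Hin Hcons} => //= y la -> /andP[ym _].
  by rewrite andbT ltnS.
have ax : all (gtn m.+1) la.
  by apply: order_path_min px => a b c /= ab /ltn_trans; apply.
have -> : all (fun y => y <= m)%N la by apply: sub_all ax => y /=.
have -> : all (fun y => y <= m.+1)%N la by apply: sub_all ax => y /= /ltnW.
by rewrite (path_sorted px).
Qed.

Lemma mem_SP N la : (la \in SP N) = is_strict_partition N la.
Proof.
rewrite mem_SP_le; case H: is_strict_partition => //=.
have /and3P[_ _ /eqP <-] := H.
elim: la {H} => //= x la IH; rewrite leq_addr /=.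
by apply: sub_all IH => y /leq_trans -> //; rewrite leq_addl.
Qed.

Lemma SP_uniq N : uniq (SP N).
Proof.
rewrite /SP; move: {1}N => m; elim: m N => [|m IH] N /=; first by case: eqP.
rewrite cat_uniq IH andbT; case: ifP => _ /=; last by apply/hasPn.
rewrite map_inj_uniq ?IH /=; last by move=> a b [].
apply/hasPn => la; rewrite mem_SP_le => /andP[_ ala].
by apply/negP => /mapP[la' _ E]; rewrite E /= ltnn in ala.
Qed.

(* The partition [(n - j, j)], read as [(n)] when [j = 0]. *)
Definition two_row (n j : nat) : seq nat :=
  if j == 0%N then [:: n] else [:: (n - j)%N; j].

(* Polynomials over [K] in countably many variables; the variable of index [k]
   stands for the odd power sum [p_(2k+1)]. *)
Notation Gamma K := {malg K[{cmonom nat}]}.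

(* Only meaningful for odd [n]. *)
Definition psum (K : fieldType) (n : nat) : Gamma K := << ucm n./2 >>.

Section MonomialEvaluation.
Variables (S : comNzRingType) (x : nat -> S).

Definition cmeval (m : {cmonom nat}) : S := \prod_(k <- finsupp m) x k ^+ m k.

Lemma cmevalEw (d : {fset nat}) (m : {cmonom nat}) :
  (finsupp m `<=` d)%fset -> cmeval m = \prod_(k <- d) x k ^+ m k.
Proof.
move=> sd; rewrite /cmeval; apply: big_fset_incl => // k _.
by rewrite -cmE_neq0 negbK => /eqP ->; rewrite expr0.
Qed.

Lemma cmeval_mmorphism : mmorphism cmeval.
Proof.
split=> [m1 m2|]; last by rewrite /cmeval mdom1 big_seq_fset0.
rewrite {1}/cmeval mdomD (cmevalEw (fsubsetUl _ (finsupp m2))).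
rewrite (cmevalEw (fsubsetUr (finsupp m1) _)) -big_split /=.
by apply: eq_bigr => k _; rewrite cmM exprD.
Qed.

HB.instance Definition _ :=
  isMultiplicative.Build {cmonom nat} S cmeval cmeval_mmorphism.
End MonomialEvaluation.

(* Algebra morphism that applies [iota] to the coefficients and sends [p_n],
   [n] odd, to [x n]. *)
Definition odd_subst (K L : fieldType) (iota : {rmorphism K -> L})
    (x : nat -> Gamma L) : {rmorphism Gamma K -> Gamma L} :=
  mmap ((malgC : L -> Gamma L) \o iota) (cmeval (fun k => x k.*2.+1)).

Definition ext (K L : fieldType) (iota : {rmorphism K -> L}) :
    {rmorphism Gamma K -> Gamma L} :=
  odd_subst iota (@psum L).

Definition rescale (K : fieldType) (c : nat -> K) :
    {rmorphism Gamma K -> Gamma K} :=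
  odd_subst (idfun : {rmorphism K -> K}) (fun n => c n *: psum K n).

(* Pfaffian of an antisymmetric matrix of even size [n]: then [ordS i] is the
   successor of [i] for every even index [i]. *)
Definition pfaffian (A : comAlgType rat) (n : nat) (M : 'M[A]_n) : A :=
  ((2 ^ n./2 * (n./2)`!)%:R^-1 : rat) *:
    \sum_(s : 'S_n) (-1) ^+ s * \prod_(i < n | ~~ odd i) M (s i) (s (ordS i)).

(* Coefficient of [z^r] in the exponential series; the inner series has no
   constant term, so truncating both series at order [r] is harmless. *)
Definition qfun (r : nat) : Gamma rat :=
  let E : {poly Gamma rat} :=
    \sum_(n < r.+1 | odd n) ((2 / n%:R : rat) *: psum rat n)%:P * 'X^n in
  \sum_(k < r.+1) ((k`!)%:R^-1 : rat) *: (E ^+ k)`_r.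

Definition Q2 (r s : nat) : Gamma rat :=
  qfun r * qfun s
  + 2 * \sum_(1 <= k < s.+1) (-1) ^+ k * (qfun (r + k) * qfun (s - k)).

Definition Qfun (la : seq nat) : Gamma rat :=
  let l := if odd (size la) then rcons la 0%N else la in
  pfaffian (\matrix_(i < size l, j < size l)
    if (i < j)%N then Q2 (nth 0%N l i) (nth 0%N l j)
    else if (j < i)%N then - Q2 (nth 0%N l j) (nth 0%N l i)
    else 0).

Local Notation "x %:F" := (@FracField.tofrac _ x).

(* Q(t,s), with [t] the inner and [s] the outer polynomial variable. *)
Definition Qts : fieldType := {fraction {poly {poly rat}}}.
Definition t_ts : Qts := ('X%:P : {poly {poly rat}})%:F.
Definition s_ts : Qts := ('X : {poly {poly rat}})%:F.
Definition iota_ts : {rmorphism rat -> Qts} :=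
  @FracField.tofrac {poly {poly rat}} \o (@polyC {poly rat} \o @polyC rat).

Definition Qt : fieldType := {fraction {poly rat}}.
Definition t_t : Qt := ('X : {poly rat})%:F.
Definition iota_t : {rmorphism rat -> Qt} := @FracField.tofrac {poly rat} \o @polyC rat.

Definition T_ts : {rmorphism Gamma Qts -> Gamma Qts} :=
  rescale (fun n => (1 - t_ts ^+ n) / (1 - s_ts ^+ n)).

Definition is_Q_expansion (K : fieldType) (iota : {rmorphism rat -> K}) (N : nat)
    (f : Gamma K) (c : seq nat -> K) : Prop :=
  f = \sum_(mu <- SP N) c mu *: ext iota (Qfun mu).

(* Meaningful when [la] and [mu] are strict partitions of the same integer: the
   coefficients [c] are then unique, the [Q_mu] being a basis. *)
Definition C (la mu : seq nat) : Qts :=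
  epsilon (inhabits (fun=> 0))
    (is_Q_expansion iota_ts (sumn la) (T_ts (ext iota_ts (Qfun la)))) mu.

(* [P(t,s) |-> P(t^2,t)] on polynomials. *)
Definition poly_at_t2_t (P : {poly {poly rat}}) : {poly rat} :=
  (map_poly (fun a : {poly rat} => a \Po 'X^2) P).['X].

(* [g(t)] is the value at [(t^2,t)] of the rational function [f(t,s)]. *)
Definition is_value_at_t2_t (f : Qts) (g : Qt) : Prop :=
  exists a b : {poly {poly rat}},
    [/\ poly_at_t2_t b != 0, f = a%:F / b%:F
      & g = (poly_at_t2_t a)%:F / (poly_at_t2_t b)%:F].

Definition value_at_t2_t (f : Qts) : Qt :=
  epsilon (inhabits 0) (is_value_at_t2_t f).

Definition C2 (la mu : seq nat) : Qt := value_at_t2_t (C la mu).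

(* [f[X + tX]] *)
Definition plethysm_1_plus_t (f : Gamma rat) : Gamma Qt :=
  rescale (fun n => 1 + t_t ^+ n) (ext iota_t f).

Definition qint (r : nat) : Qt := \sum_(i < r) t_t ^+ i.

(* Main.v *)
(** The generating series of the [q_r] is an exponential, so
    [r q_r = 2 sum_(k odd) p_k q_(r-k)].  Uniqueness of the solution of this
    recurrence gives [q_n[X + uX] = sum_i u^i q_i q_(n-i)], which vanishes at
    [u = -1] for [n > 0].  With [a_i = q_(n-i) q_i] and
    [A_j = sum_(i < j) (-1)^i a_i] one has
    [Q_(n-j,j) = (-1)^j (A_(j+1) + A_j)], and the claimed expansion of
    [q_n[X + tX]] telescopes.

    To pass to the coefficients [C^[2]], one needs that the [Q_mu] form a basis.
    They span: up to products with a larger sum of squares of indices, [Q_la] is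
    [q_la] (the signs of the perfect matchings in the Pfaffian add up to 1), and a
    repeated factor [q_m^2] is a combination of such larger products.  They are
    independent because Glaisher's map embeds strict partitions of [N] into
    partitions of [N] with odd parts, so that their number does not exceed the
    dimension of [Gamma_N]. *)

Require Import Defs.
From Stdlib Require Import ClassicalEpsilon.
From mathcomp Require Import all_boot all_order all_fingroup all_algebra.
From mathcomp Require Import finmap monalg.
From mathcomp Require Import ring zify.

Import GRing.Theory.
Local Open Scope ring_scope.

(** * Sums over permutations of Pfaffian type *)

Section EvenPairs.
Variables (R : Type) (idx : R) (op : Monoid.com_law idx).

Lemma big_even_pairs_recl (m : nat) (F : 'I_m.+1.*2 -> 'I_m.+1.*2 -> R) :
  \big[op/idx]_(i < m.+1.*2 | ~~ odd i) F i (ordS i) =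
  op (F ord0 (lift ord0 ord0))
     (\big[op/idx]_(i < m.*2 | ~~ odd i)
        F (lift ord0 (lift ord0 i)) (lift ord0 (lift ord0 (ordS i)))).
Proof.
rewrite big_mkcond big_ord_recl big_ord_recl /= Monoid.mul1m -big_mkcond /=.
congr (op (F _ _) _); first by apply: val_inj.
rewrite big_mkcond [RHS]big_mkcond; apply: eq_bigr => i _.
rewrite add0n negbK; case: ifP => // oi; congr (F _ _); apply: val_inj => /=.
(* As [i] is even, its successor is still below [m.*2], so the cyclic [ordS] does not wrap
   around. *)
have lti : (i.+1 < m.*2)%N by have ltim : (i < m.*2)%N := ltn_ord i; lia.
by rewrite /bump /= ?add1n !modn_small.
Qed.

Lemma big_even_pairs (m : nat) (h : 'I_m.*2 -> R) :
  \big[op/idx]_(i < m.*2 | ~~ odd i) op (h i) (h (ordS i)) =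
  \big[op/idx]_(i < m.*2) h i.
Proof.
elim: m h => [|m IH] h; first by rewrite !big_ord0.
rewrite (big_even_pairs_recl m (fun i j => op (h i) (h j))).
rewrite (IH (fun i => h (lift ord0 (lift ord0 i)))).
by rewrite big_ord_recl big_ord_recl Monoid.mulmA.
Qed.
End EvenPairs.

Section PfaffianSum.
Variable R : comNzRingType.

(** The Pfaffian without its normalising factor. Taking a function instead of a matrix turns
    deletion of rows and columns into precomposition with [lift]. *)
Definition pfaffian_sum (n : nat) (M : 'I_n -> 'I_n -> R) : R :=
  \sum_(s : 'S_n) (-1) ^+ s * \prod_(i < n | ~~ odd i) M (s i) (s (ordS i)).

Lemma pfaffian_sum0 (M : 'I_0 -> 'I_0 -> R) : pfaffian_sum 0 M = 1.
Proof.
rewrite /pfaffian_sum (big_pred1 1%g) => [|s].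
  by rewrite big_ord0 odd_perm1 mulr1.
by apply/esym/eqP/permP => -[].
Qed.

(** A permutation amounts to the image [a] of 0 and a permutation of the remaining points;
    injectivity and equal cardinalities give the bijection. *)
Lemma sum_perm_recl (n : nat) (F : 'S_n.+1 -> R) :
  \sum_s F s = \sum_(a < n.+1) \sum_(s : 'S_n) F (lift_perm ord0 a s).
Proof.
rewrite pair_big /= (reindex (fun p => lift_perm ord0 p.1 p.2)) //.
apply: onW_bij; apply: inj_card_bij => [[a s] [b t] /= E|].
  have eab : a = b by have := congr1 (fun f : 'S_n.+1 => f ord0) E; rewrite !lift_perm_id.
  rewrite -eab in E *; congr (_, _); apply/permP => i.
  have := congr1 (fun f : 'S_n.+1 => f (lift ord0 i)) E.
  by rewrite !lift_perm_lift => /lift_inj.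
by rewrite card_prod card_ord !card_Sn factS.
Qed.

(** Splits off the positions 0 and 1, with images [a] and [lift a b]; removing each image
    contributes one power of -1. *)
Lemma pfaffian_sum_recl (m : nat) (M : 'I_m.+1.*2 -> 'I_m.+1.*2 -> R) :
  pfaffian_sum m.+1.*2 M =
  \sum_(a < m.+1.*2) \sum_(b < m.*2.+1) (-1) ^+ (a + b) * M a (lift a b) *
     pfaffian_sum m.*2 (fun i j => M (lift a (lift b i)) (lift a (lift b j))).
Proof.
rewrite /pfaffian_sum sum_perm_recl; apply: eq_bigr => a _.
rewrite sum_perm_recl; apply: eq_bigr => b _.
rewrite big_distrr; apply: eq_bigr => s _ /=.
rewrite (big_even_pairs_recl _ _ _ m (fun i j =>
  M (lift_perm ord0 a (lift_perm ord0 b s) i) (lift_perm ord0 a (lift_perm ord0 b s) j))).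
rewrite !lift_perm_lift !lift_perm_id !odd_lift_perm /= !signr_addb.
rewrite (signr_odd _ a) (signr_odd _ b) (exprD _ a).
under eq_bigr do rewrite !lift_perm_lift.
by rewrite -!mulrA; congr (_ * (_ * _)); rewrite mulrA mulrCA -mulrA.
Qed.

Definition ord_sign (n : nat) (i j : 'I_n) : R :=
  if (i < j)%N then 1 else if (j < i)%N then -1 else 0.

Lemma sum_alternating (n : nat) : \sum_(b < n) (-1) ^+ b = (odd n)%:R :> R.
Proof.
elim: n => [|n IH]; first by rewrite big_ord0.
by rewrite big_ord_recr IH /= -signr_odd; case: odd => /=; rewrite ?addrN ?add0r.
Qed.

(** Since [lift a b] exceeds [a] exactly when [b] is at least [a], the sum is (-1)^a times an
    alternating sum of odd length minus twice its first [a] terms: (-1)^a (1 - 2 [a odd]) = 1. *)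
Lemma sum_ord_sign (m : nat) (a : 'I_m.+1.*2) :
  \sum_(b < m.*2.+1) (-1) ^+ (a + b) * ord_sign _ a (lift a b) = 1 :> R.
Proof.
have E (b : 'I_m.*2.+1) : ord_sign _ a (lift a b) = 1 - (if (b < a)%N then 2 else 0).
  rewrite /ord_sign /= /bump; case: (leqP a b) => ab /=.
    by rewrite add1n ltnS ab subr0.
  by rewrite add0n ab ltnNge (ltnW ab) /=; ring.
under eq_bigr do rewrite E exprD -mulrA mulrBr mulr1.
rewrite -big_distrr sumrB sum_alternating /= odd_double /=.
have -> : \sum_(b < m.*2.+1) (-1) ^+ b * (if (b < a)%N then 2 else 0) = 2 * (odd a)%:R :> R.
  rewrite -sum_alternating big_distrr /=.
  rewrite (big_ord_widen m.*2.+1 (fun b => 2 * (-1) ^+ b)); last first.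
    exact: ltn_ord a.
  rewrite [RHS]big_mkcond; apply: eq_bigr => b _.
  by case: ifP => _; rewrite ?mulr0 // mulrC.
by rewrite -signr_odd; case: odd => /=; ring.
Qed.

(** In other words, the sign matrix has Pfaffian 1. Deleting two indices leaves a smaller sign
    matrix, and each of the 2m+2 values of [a] contributes 2^m m!. *)
Lemma pfaffian_sum_ord_sign (m : nat) :
  pfaffian_sum m.*2 (@ord_sign m.*2) = (2 ^ m * m`!)%:R.
Proof.
elim: m => [|m IH]; first by rewrite pfaffian_sum0.
rewrite pfaffian_sum_recl.
transitivity (\sum_(a < m.+1.*2) (2 ^ m * m`!)%:R : R).
  apply: eq_bigr => a _.
  under eq_bigr => b _.
    rewrite (_ : pfaffian_sum _ _ = (2 ^ m * m`!)%:R); last first.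
      rewrite -IH; apply: eq_bigr => s _; congr (_ * _); apply: eq_bigr => i _.
      rewrite /ord_sign /=.
      have H (x y : nat) (c : nat) : (bump c x < bump c y)%N = (x < y)%N.
        by rewrite !ltnNge leq_bump2.
      by rewrite !H.
    over.
  by rewrite -mulr_suml sum_ord_sign mul1r.
rewrite sumr_const card_ord -mulrnA; congr _%:R.
by rewrite factS expnS; lia.
Qed.
End PfaffianSum.

Lemma pfaffian2 (A : comAlgType rat) (M : 'M[A]_2) :
  M ord_max ord0 = - M ord0 ord_max -> pfaffian M = M ord0 ord_max.
Proof.
move=> anti; rewrite /pfaffian -[\sum_s _]/(pfaffian_sum A 1.*2 M).
rewrite (pfaffian_sum_recl A 0).
rewrite !big_ord_recl !big_ord0 !pfaffian_sum0.
have -> : lift (ord0 : 'I_1.*2) (ord0 : 'I_1) = ord_max :> 'I_2 by apply: val_inj.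
have -> : lift (ord_max : 'I_2) (ord0 : 'I_1) = ord0 :> 'I_2 by apply: val_inj.
rewrite /bump /= anti.
have -> : (2 ^ 1 * 1`!)%N = 2%N by [].
rewrite (_ : _ + _ = 2%:R *: M ord0 ord_max); last by rewrite scaler_nat; ring.
by rewrite scalerA mulVf ?scale1r.
Qed.

(** * The recurrence for the functions q_r *)

Section TruncatedExponential.
Variable A : comAlgType rat.

Lemma coef_exp_trunc (p q : {poly A}) (r : nat) :
  (forall i, (i <= r)%N -> p`_i = q`_i) ->
  forall k i, (i <= r)%N -> (p ^+ k)`_i = (q ^+ k)`_i.
Proof.
move=> pq; elim=> [|k IH] i ir; first by rewrite !expr0.
rewrite !exprS !coefM; apply: eq_bigr => j _.
by rewrite pq ?IH //; have := ltn_ord j; lia.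
Qed.

Lemma coef_exp_small (p : {poly A}) :
  p`_0 = 0 -> forall k i, (i < k)%N -> (p ^+ k)`_i = 0.
Proof.
move=> p0; elim=> [|k IH] i ik //.
rewrite exprS coefM big1 // => j _.
have [->|j0] := eqVneq (j : nat) 0%N; first by rewrite p0 mul0r.
by rewrite IH ?mulr0 //; have := ltn_ord j; lia.
Qed.

Variable c : nat -> A.

(** When [c 0 = 0], this is the coefficient of z^r in exp(sum_i c_i z^i). *)
Definition exp_coef (r : nat) : A :=
  \sum_(k < r.+1) (k`!%:R^-1 : rat) *: ((\poly_(i < r.+1) c i) ^+ k)`_r.

Hypothesis c0 : c 0 = 0.

(** Powers above the [r]-th start beyond z^r, so one truncation order [R] serves all coefficients up
    to [R]. *)
Lemma exp_coef_widen (r R : nat) : (r <= R)%N ->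
  exp_coef r = \sum_(k < R.+1) (k`!%:R^-1 : rat) *: ((\poly_(i < R.+1) c i) ^+ k)`_r.
Proof.
move=> rR; rewrite /exp_coef.
rewrite (big_ord_widen R.+1 (fun k => (k`!%:R^-1 : rat) *: ((\poly_(i < r.+1) c i) ^+ k)`_r)) //.
rewrite big_mkcond; apply: eq_bigr => k _.
case: ltnP => kr.
  congr (_ *: _); apply: coef_exp_trunc (leqnn r) => i ir.
  by rewrite !coef_poly !ltnS ir (leq_trans ir rR).
by rewrite coef_exp_small ?scaler0 // coef_poly.
Qed.

(** Compares the coefficients of z^r in (exp E)' = E' exp E. *)
Lemma exp_coef_recl (r : nat) :
  r.+1%:R * exp_coef r.+1 =
  \sum_(k < r.+1) k.+1%:R * c k.+1 * exp_coef (r - k).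
Proof.
pose E := \poly_(i < r.+2) c i.
pose u k : A := (k`!%:R^-1 : rat)%:A.
have uS k : u k.+1 *+ k.+1 = u k.
  rewrite /u scalerMnl -mulr_natr; congr (_ *: _).
  rewrite factS natrM invfM [X in X * _]mulrC -mulrA mulVf ?mulr1 //.
  by rewrite Num.Theory.pnatr_eq0.
pose P := \sum_(k < r.+2) u k *: E ^+ k.
have coefP i : (i <= r.+1)%N -> P`_i = exp_coef i.
  move=> ir; rewrite (exp_coef_widen _ r.+1) // coef_sum; apply: eq_bigr => k _.
  by rewrite coefZ mulr_algl.
have E0 : E`_0 = 0 by rewrite coef_poly.
(* Differentiating the truncated exponential loses its top term, which has no coefficient in degrees
   up to [r]. *)
have derP : P^`() = E^`() * (P - u r.+1 *: E ^+ r.+1).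
  have -> : P^`() = \sum_(k < r.+2) (u k *: E ^+ k)^`() by rewrite raddf_sum.
  have -> : P - u r.+1 *: E ^+ r.+1 = \sum_(k < r.+1) u k *: E ^+ k.
    by rewrite /P big_ord_recr /= addrK.
  rewrite big_distrr big_ord_recl /=.
  rewrite expr0 derivZ derivC scaler0 add0r; apply: eq_bigr => k _.
  by rewrite derivZ deriv_exp /= -scalerAr -[in RHS]uS -scalerMnl -scalerMnr.
have := congr1 (fun p : {poly A} => p`_r) derP.
rewrite coef_deriv coefP // mulr_natl => ->.
rewrite coefM; apply: eq_bigr => k _.
rewrite coefB coefZ coef_exp_small // ?mulr0 ?subr0; last by rewrite ltnS leq_subr.
rewrite coefP ?coef_deriv; last by rewrite leqW // leq_subr.
by rewrite coef_poly ltnS ltn_ord mulr_natl.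
Qed.
End TruncatedExponential.

Lemma qfun_exp_coef (r : nat) :
  qfun r = exp_coef (Gamma rat)
    (fun n => if odd n then (2 / n%:R : rat) *: psum rat n else 0) r.
Proof.
rewrite /qfun /exp_coef; apply: eq_bigr => k _.
rewrite poly_def big_mkcond; congr (_ *: coefp r (_ ^+ k)); apply: eq_bigr => n _.
by case: odd; rewrite ?scale0r // mul_polyC.
Qed.

(** The coefficient of z^k in the derivative of 2 sum_(n odd) p_n z^n / n, hence the shifted
    index. *)
Definition odd_psum (K : fieldType) (k : nat) : Gamma K :=
  if odd k then 0 else 2 *: psum K k.+1.

Lemma qfun_recl (r : nat) :
  r.+1%:R * qfun r.+1 = \sum_(k < r.+1) odd_psum rat k * qfun (r - k).
Proof.
rewrite qfun_exp_coef (exp_coef_recl _ _ (erefl 0)).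
apply: eq_bigr => k _.
rewrite -qfun_exp_coef /odd_psum oddS.
case: (odd k); first by rewrite mulr0.
rewrite [~~ false]/=; have k0 : (k.+1%:R : rat) != 0 by rewrite Num.Theory.pnatr_eq0.

by rewrite mulr_natl scalerMnl -mulr_natr (divfK k0).
Qed.

Lemma qfun0 : qfun 0 = 1.
Proof. by rewrite /qfun big_ord1 expr0 coef1 /= invr1 scale1r. Qed.

(** Dividing by r+1 determines each value from the earlier ones; [iota] forces [K] to have
    characteristic zero. *)
Lemma linear_recurrence_unique (K : fieldType) (iota : {rmorphism rat -> K})
    (c f g : nat -> Gamma K) :
  (forall r, r.+1%:R * f r.+1 = \sum_(k < r.+1) c k * f (r - k)%N) ->
  (forall r, r.+1%:R * g r.+1 = \sum_(k < r.+1) c k * g (r - k)%N) ->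
  f 0 = g 0 -> f =1 g.
Proof.
move=> fE gE fg0 r; elim/ltn_ind: r => -[|r] IH //.
have r0 : (r.+1%:R : K) != 0.
  by rewrite -(rmorph_nat iota) fmorph_eq0 Num.Theory.pnatr_eq0.
have E : r.+1%:R * f r.+1 = r.+1%:R * g r.+1.
  rewrite fE gE; apply: eq_bigr => k _.
  by rewrite (IH (r - k)%N) // ltnS leq_subr.
have natE (x : Gamma K) : r.+1%:R * x = (r.+1%:R : K) *: x.
  by rewrite scaler_nat mulr_natl.
by move: E; rewrite !natE; apply: scalerI.
Qed.

(** For generating series, F' = C F implies that G(z) = F(uz) F(z) satisfies G' = (C(z) + u C(uz))
    G. Below, [U] and [C'] truncate F(uz) and u C(uz). *)
Lemma linear_recurrence_convolution (A : comNzRingType) (u : A) (c f : nat -> A) :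
  (forall r, r.+1%:R * f r.+1 = \sum_(k < r.+1) c k * f (r - k)%N) ->
  let h r := \sum_(i < r.+1) u ^+ i * (f i * f (r - i)%N) in
  forall r, r.+1%:R * h r.+1 = \sum_(k < r.+1) ((1 + u ^+ k.+1) * c k) * h (r - k)%N.
Proof.
move=> fE h r.
pose F := \poly_(i < r.+2) f i; pose U := \poly_(i < r.+2) (u ^+ i * f i).
pose C := \poly_(i < r.+2) c i; pose C' := \poly_(i < r.+2) (u ^+ i.+1 * c i).
have coefh i : (i <= r.+1)%N -> (U * F)`_i = h i.
  move=> ir; rewrite coefM; apply: eq_bigr => j _.
  rewrite !coef_poly !ltnS (leq_trans (leq_subr _ _) ir).
  by rewrite (leq_trans _ ir) ?mulrA // -ltnS.
have coefF i : (i <= r)%N -> F^`()`_i = (C * F)`_i.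
  move=> ir; rewrite coef_deriv coefM coef_poly !ltnS ir -mulr_natl fE.
  apply: eq_bigr => j _; have ji := leq_trans (ltn_ord j) (ir : (i < r.+1)%N).
  by rewrite !coef_poly !ltnS (leq_trans (leq_subr _ _) (leqW ir)) (ltnW ji).
have coefU i : (i <= r)%N -> U^`()`_i = (C' * U)`_i.
  move=> ir; rewrite coef_deriv coefM coef_poly !ltnS ir -mulr_natl mulrCA fE.
  rewrite big_distrr; apply: eq_bigr => j _ /=.
  have ji := leq_trans (ltn_ord j) (ir : (i < r.+1)%N).
  rewrite !coef_poly !ltnS (leq_trans (leq_subr _ _) (leqW ir)) (ltnW ji).
  have -> : u ^+ i.+1 = u ^+ j.+1 * u ^+ (i - j) by rewrite -exprD addSn subnKC // -ltnS.
  by rewrite -!mulrA; congr (_ * _); rewrite mulrCA.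
have trunc (p p' q : {poly A}) : (forall i, (i <= r)%N -> p`_i = p'`_i) ->
    (p * q)`_r = (p' * q)`_r.
  move=> pp; rewrite !coefM; apply: eq_bigr => j _.
  by rewrite pp // -ltnS.
rewrite mulr_natl -coefh // -coef_deriv derivM coefD (trunc _ _ F coefU).
rewrite [U * _]mulrC (trunc _ _ U coefF) -coefD.
have -> : C' * U * F + C * F * U = (C + C') * (U * F) by ring.
rewrite coefM; apply: eq_bigr => j _.
rewrite coefh; last by rewrite leqW // leq_subr.
by rewrite coefD !coef_poly ltnS ltnW // [in RHS]mulrDl mul1r.
Qed.

(** * The two-row identity *)

Section TwoRowIdentity.
Variables (A : comNzRingType) (q : nat -> A) (t : A) (n : nat).

Lemma big_ord_fold (c h : nat) (F : nat -> A) :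
  \sum_(i < c + h) F i = \sum_(i < c) F i + \sum_(i < h) F (c + h - i.+1)%N.
Proof.
rewrite big_split_ord /=; congr (_ + _).
rewrite (reindex_inj rev_ord_inj); apply: eq_bigr => i _ /=.
by rewrite addnBA.
Qed.

Let a i := q (n - i) * q i.
Let altsum J := \sum_(i < J) (-1) ^+ i * a i.
Let d j := t ^+ j * (1 + t) * \sum_(i < n - j.*2) t ^+ i.
(** The boundary term of the telescoping sum: [d j] differs from both [g j] and [g j.+1] by t^j +
    t^(n-j), with opposite signs. *)
Let g j := 2 * t ^+ j * \sum_(i < n.+1 - j.*2) t ^+ i.

Definition two_row_q (r s : nat) : A :=
  q r * q s + 2 * \sum_(1 <= k < s.+1) (-1) ^+ k * (q (r + k)%N * q (s - k)%N).

(** Substituting i = j - k, the sum in Q_(n-j,j) runs over twice the a_i with i < j, with signs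
    (-1)^(j-i), and the leading product is a_j. *)
Lemma two_row_q_altsum (j : nat) : (j <= n)%N ->
  two_row_q (n - j) j = (-1) ^+ j * (altsum j.+1 + altsum j).
Proof.
move=> jn; rewrite {1}/altsum big_ord_recr /= -/(altsum j) /two_row_q.
rewrite big_add1 big_mkord (reindex_inj rev_ord_inj) /=.
have -> : \sum_(i < j) (-1) ^+ (j - i.+1).+1 *
    (q (n - j + (j - i.+1).+1)%N * q (j - (j - i.+1).+1)%N) = (-1) ^+ j * altsum j.
  rewrite big_distrr; apply: eq_bigr => i _ /=.
  have ij := ltn_ord i.
  have -> : ((j - i.+1).+1 = j - i)%N by lia.
  have -> : (n - j + (j - i) = n - i)%N by lia.
  have -> : (j - (j - i) = i)%N by lia.
  by rewrite mulrA -signr_odd oddB 1?ltnW // signr_addb !signr_odd.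
have e2 : (-1) ^+ j * (-1) ^+ j = 1 :> A by rewrite -exprD addnn -signr_odd odd_double.
rewrite [RHS](_ : _ = (-1) ^+ j * (-1) ^+ j * a j + 2 * ((-1) ^+ j * altsum j)); last by ring.
by rewrite e2 mul1r.
Qed.

Lemma geometric_recl (m : nat) : \sum_(i < m.+1) t ^+ i = 1 + t * \sum_(i < m) t ^+ i.
Proof.
rewrite big_ord_recl expr0 big_distrr; congr (_ + _).
by apply: eq_bigr => i _; rewrite exprS.
Qed.

Lemma two_row_coef (j : nat) : (j.*2 < n)%N ->
  d j = (t ^+ j + t ^+ (n - j)) + g j.+1 /\ d j = g j - (t ^+ j + t ^+ (n - j)).
Proof.
move=> jn; have [m Em] : exists m, n = (j.*2 + m.+1)%N.
  by exists (n - j.*2).-1; lia.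
have -> : t ^+ (n - j) = t ^+ j * t ^+ m.+1 by rewrite -exprD; congr (_ ^+ _); lia.
rewrite /d /g.
have -> : (n - j.*2 = m.+1)%N by lia.
have -> : (n.+1 - j.*2 = m.+2)%N by lia.
have -> : (n.+1 - j.+1.*2 = m)%N by lia.
have Er : 1 + t * (\sum_(i < m) t ^+ i) = \sum_(i < m) t ^+ i + t ^+ m.
  by rewrite -geometric_recl big_ord_recr.
rewrite !geometric_recl !exprS.
set s := \sum_(i < m) _ in Er *; set x := t ^+ j; set y := t ^+ m in Er *.
(* Eliminating t^m through the geometric sum [s] leaves polynomial identities. *)
have -> : y = 1 + t * s - s by rewrite Er; ring.
by split; ring.
Qed.

Lemma two_row_partial_sum (J : nat) : (J <= uphalf n)%N ->
  \sum_(j < J) d j * two_row_q (n - j) j =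
  \sum_(i < J) (t ^+ i + t ^+ (n - i)) * a i - (-1) ^+ J * g J * altsum J.
Proof.
elim: J => [|J IH] Jn; first by rewrite !big_ord0 /altsum big_ord0; ring.
rewrite !big_ord_recr /= IH ?(ltnW Jn) // two_row_q_altsum; last by lia.
have [d1 d2] := two_row_coef J ltac:(lia).
have aE : a J = (-1) ^+ J * (altsum J.+1 - altsum J).
  rewrite {1}/altsum big_ord_recr /= -/(altsum J) addrAC subrr add0r mulrA.
  by rewrite -exprD addnn -signr_odd odd_double mul1r.
(* The copy of [d J] next to [altsum J.+1] is expanded through [g J.+1], the other through [g J],
   which cancels the boundary term of the induction hypothesis. *)
have -> : d J * ((-1) ^+ J * (altsum J.+1 + altsum J)) =
    (-1) ^+ J * (d J * altsum J.+1 + d J * altsum J) by ring.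
by rewrite {1}d1 d2 aE exprS; ring.
Qed.

(** The partial sum is taken up to [uphalf n]. For odd [n] the boundary term is an empty geometric
    sum; for even [n] it is the middle term of the left side, by the relation at u = -1. *)
Lemma two_row_identity :
  (0 < n)%N ->
  \sum_(i < n.+1) (-1) ^+ i * (q i * q (n - i)%N) = 0 ->
  \sum_(i < n.+1) t ^+ i * (q i * q (n - i)%N) =
  \sum_(j < n | (j.*2 < n)%N) d j * two_row_q (n - j) j.
Proof.
move=> n0 rel.
have -> : \sum_(j < n | (j.*2 < n)%N) d j * two_row_q (n - j) j =
    \sum_(j < uphalf n) d j * two_row_q (n - j) j.
  rewrite (big_ord_widen n (fun j => d j * two_row_q (n - j) j)); last by lia.
  by apply: eq_bigl => j; lia.
rewrite two_row_partial_sum //.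
have aC i : q i * q (n - i)%N = a i by rewrite mulrC.
have aN i : (i <= n)%N -> a (n - i)%N = a i.
  by move=> le; rewrite /a subKn // mulrC.
(* Pairs [i] with [n - i], leaving a middle term for even [n]. It is applied with u = t to the goal
   and with u = -1 to the relation. *)
have fold (u : A) : \sum_(i < n.+1) u ^+ i * (q i * q (n - i)%N) =
    \sum_(i < uphalf n) (u ^+ i + u ^+ (n - i)) * a i +
      (if odd n then 0 else u ^+ n./2 * a n./2).
  have -> : n.+1 = ((n.+1 - uphalf n) + uphalf n)%N by lia.
  rewrite (big_ord_fold _ _ (fun i => u ^+ i * (q i * q (n - i)%N))).
  have sE : \sum_(i < uphalf n) (u ^+ i + u ^+ (n - i)) * a i =
     \sum_(i < uphalf n) u ^+ i * a i + \sum_(i < uphalf n) u ^+ (n - i) * a i.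
    by rewrite -big_split; apply: eq_bigr => i _; rewrite mulrDl.
  have -> : \sum_(i < uphalf n) u ^+ (n.+1 - uphalf n + uphalf n - i.+1) *
      (q (n.+1 - uphalf n + uphalf n - i.+1)%N *
       q (n - (n.+1 - uphalf n + uphalf n - i.+1))%N)
      = \sum_(i < uphalf n) u ^+ (n - i) * a i.
    apply: eq_bigr => i _; have := ltn_ord i => ilt.
    have -> : (n.+1 - uphalf n + uphalf n - i.+1 = n - i)%N by lia.
    by rewrite aC aN //; lia.
  rewrite sE addrAC; congr (_ + _).
  case: ifP => on.
    have -> : (n.+1 - uphalf n)%N = uphalf n by lia.
    by rewrite addr0; apply: eq_bigr => i _; rewrite aC.
  have -> : (n.+1 - uphalf n)%N = (uphalf n).+1 by lia.
  rewrite big_ord_recr /= aC; congr (_ + _); first by apply: eq_bigr => i _; rewrite aC.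
  by have -> : uphalf n = n./2 by lia.
rewrite fold; congr (_ + _).
move: rel; rewrite fold; case: ifP => on.
  have -> : g (uphalf n) = 0.
    rewrite /g; have -> : (n.+1 - (uphalf n).*2 = 0)%N by lia.
    by rewrite big_ord0 mulr0.
  by move=> _; ring.
have -> : uphalf n = n./2 by lia.
have -> : \sum_(i < n./2) ((-1) ^+ i + (-1) ^+ (n - i)) * a i = 2 * altsum n./2.
  rewrite big_distrr; apply: eq_bigr => i _ /=; have := ltn_ord i => ilt.
  by rewrite -(signr_odd _ (n - i)) oddB ?on /= ?signr_odd; [ring|lia].
have e2 : (-1) ^+ n./2 * (-1) ^+ n./2 = 1 :> A by rewrite -exprD addnn -signr_odd odd_double.
move=> rel.
have -> : a n./2 = - ((-1) ^+ n./2 * (2 * altsum n./2)).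
  move/eqP: rel; rewrite addrC addr_eq0 => /eqP rel.
  by rewrite -mulrN -rel mulrA e2 mul1r.
rewrite /g; have -> : (n.+1 - (n./2).*2 = 1)%N by lia.
by rewrite big_ord1 expr0; ring.
Qed.
End TwoRowIdentity.

(** * The one-row plethysm *)

Section Substitution.
Variables (K L : fieldType) (iota : {rmorphism K -> L}).

Lemma odd_subst_psum (x : nat -> Gamma L) (n : nat) :
  odd n -> odd_subst iota x (psum K n) = x n.
Proof.
move=> on; rewrite /odd_subst /= mmapU /= rmorph1 mpolyC1E mul1r.
rewrite /cmeval mdomU big_seq_fset1 cmUU expr1; congr x.
by rewrite -add1n -[in RHS](odd_double_half n) on.
Qed.

Lemma odd_substZ (x : nat -> Gamma L) (a : K) (f : Gamma K) :
  odd_subst iota x (a *: f) = iota a *: odd_subst iota x f.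
Proof. by rewrite /odd_subst /= mmapZ mul_malgC. Qed.

Lemma ext_odd_psum (k : nat) : ext iota (odd_psum K k) = odd_psum L k.
Proof.
rewrite /odd_psum; case: ifP => ok; first by rewrite rmorph0.
have oSk : odd k.+1 by rewrite oddS ok.
by rewrite /ext odd_substZ (odd_subst_psum _ _ oSk) rmorph_nat.
Qed.
End Substitution.

Lemma rescale_odd_psum (K : fieldType) (c : nat -> K) (k : nat) :
  rescale c (odd_psum K k) = c k.+1 *: odd_psum K k.
Proof.
rewrite /odd_psum; case: ifP => ok; first by rewrite rmorph0 scaler0.
have oSk : odd k.+1 by rewrite oddS ok.
by rewrite /rescale odd_substZ (odd_subst_psum _ _ _ _ _ oSk) !scalerA mulrC.
Qed.

Section QFunctions.
Variables (K : fieldType) (iota : {rmorphism rat -> K}).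

Lemma ext_qfun_recl (r : nat) :
  r.+1%:R * ext iota (qfun r.+1) = \sum_(k < r.+1) odd_psum K k * ext iota (qfun (r - k)).
Proof.
rewrite -(rmorph_nat (ext iota)) -rmorphM qfun_recl rmorph_sum.
by apply: eq_bigr => k _; rewrite rmorphM ext_odd_psum.
Qed.

(** Both sides start at 1 and satisfy the recurrence with coefficients (1 + u^(k+1))
    [odd_psum K k]. *)
Lemma rescale_qfun (u : K) (r : nat) :
  rescale (fun n => 1 + u ^+ n) (ext iota (qfun r)) =
  \sum_(i < r.+1) u%:A ^+ i * (ext iota (qfun i) * ext iota (qfun (r - i))).
Proof.
pose c k : Gamma K := (1 + u%:A ^+ k.+1) * odd_psum K k.
pose R := rescale (fun n => 1 + u ^+ n).
pose h m := \sum_(i < m.+1) u%:A ^+ i * (ext iota (qfun i) * ext iota (qfun (m - i))).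
apply: (linear_recurrence_unique K iota c (fun m => R (ext iota (qfun m))) h) => {r}.
- move=> r; rewrite -(rmorph_nat R) -rmorphM ext_qfun_recl rmorph_sum.
  apply: eq_bigr => k _; rewrite rmorphM rescale_odd_psum; congr (_ * _).
  by rewrite /c scalerDl scale1r mulrDl mul1r -in_algE -rmorphXn mulr_algl.
- exact: (linear_recurrence_convolution _ u%:A _ (fun m => ext iota (qfun m)) ext_qfun_recl).
by rewrite /h big_ord1 expr0 mul1r /R qfun0 !rmorph1 mulr1.
Qed.
End QFunctions.

(** At u = -1 the factor 1 + u^(k+1) vanishes for even [k], and [odd_psum] vanishes for odd [k]. *)
Lemma qfun_alternating_sum (r : nat) :
  (0 < r)%N -> \sum_(i < r.+1) (-1) ^+ i * (qfun i * qfun (r - i)) = 0.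
Proof.
case: r => // r _.
have E := linear_recurrence_convolution _ (-1) _ _ qfun_recl r.
have r0 : (r.+1%:R : rat) != 0 by rewrite Num.Theory.pnatr_eq0.
apply: (scalerI r0); rewrite scaler0 scaler_nat -mulr_natl E big1 // => k _.
rewrite /odd_psum -signr_odd oddS; case: (odd k); first by rewrite mulr0 mul0r.
by rewrite /= expr1 subrr !mul0r.
Qed.

Lemma Qfun_two_parts (r s : nat) : Qfun [:: r; s] = Q2 r s.
Proof. by rewrite [LHS]pfaffian2 !mxE. Qed.

Lemma Qfun_one_part (n : nat) : Qfun [:: n] = qfun n.
Proof.
rewrite [LHS]pfaffian2 !mxE //= /Q2 big_geq // mulr0 addr0.
by rewrite qfun0 mulr1.
Qed.

Lemma rmorph_two_row_q (A B : comNzRingType) (f : {rmorphism A -> B}) (q : nat -> A)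
    (r s : nat) :
  f (two_row_q A q r s) = two_row_q B (fun i => f (q i)) r s.
Proof.
rewrite /two_row_q rmorphD !rmorphM rmorph_nat rmorph_sum; congr (_ + _ * _).
by apply: eq_bigr => k _; rewrite !rmorphM rmorphXn rmorphN1.
Qed.

Lemma Qfun_two_row (n j : nat) : Qfun (two_row n j) = two_row_q _ qfun (n - j) j.
Proof.
rewrite /two_row; case: eqP => [->|_]; last by rewrite Qfun_two_parts.
by rewrite Qfun_one_part subn0 /two_row_q big_geq // mulr0 addr0 qfun0 mulr1.
Qed.

Lemma plethysm_one_row (n : nat) : (1 <= n)%N ->
  plethysm_1_plus_t (Qfun [:: n]) =
    \sum_(j < n | (j.*2 < n)%N)
      (t_t ^+ j * (1 + t_t) * qint (n - j.*2)) *: ext iota_t (Qfun (two_row n j)).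
Proof.
move=> n0; rewrite Qfun_one_part /plethysm_1_plus_t rescale_qfun.
rewrite (two_row_identity _ (fun i => ext iota_t (qfun i)) _ _ n0).
  apply: eq_bigr => j _; rewrite Qfun_two_row rmorph_two_row_q -[RHS]mulr_algl; congr (_ * _).
  rewrite -!in_algE !rmorphM rmorphD rmorph1 rmorphXn rmorph_sum.
  by congr (_ * _); apply: eq_bigr => i _; rewrite rmorphXn.
have := congr1 (ext iota_t) (qfun_alternating_sum n n0).
rewrite rmorph0 rmorph_sum => E; rewrite -[RHS]E; apply: eq_bigr => i _.
rewrite (rmorphM _ ((-1) ^+ i)) rmorphXn rmorphN1; congr (_ * _).
by rewrite (rmorphM _ (qfun i)).
Qed.

(** * Leading terms of Q-functions *)

(** Linear span as an inductive predicate, so that closure properties follow by induction on the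
    construction of a vector. *)
Inductive lspan (K : fieldType) (V : lmodType K) (G : V -> Prop) : V -> Prop :=
| lspan0 : lspan K V G 0
| lspan_gen x : G x -> lspan K V G x
| lspanD x y : lspan K V G x -> lspan K V G y -> lspan K V G (x + y)
| lspanZ a x : lspan K V G x -> lspan K V G (a *: x).

Arguments lspan {K V} G x.

Section Span.
Variable K : fieldType.

Lemma lspanN (V : lmodType K) (G : V -> Prop) (x : V) : lspan G x -> lspan G (- x).
Proof. by rewrite -scaleN1r => ?; apply: lspanZ. Qed.

Lemma lspanB (V : lmodType K) (G : V -> Prop) (x y : V) :
  lspan G x -> lspan G y -> lspan G (x - y).
Proof. by move=> ? /lspanN; apply: lspanD. Qed.

Lemma lspan_sign (V : algType K) (G : V -> Prop) (k : nat) (x : V) :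
  lspan G x -> lspan G ((-1) ^+ k * x).
Proof. by rewrite -signr_odd; case: odd; rewrite ?mulN1r ?mul1r //; apply: lspanN. Qed.

Lemma lspan_sum (V : lmodType K) (G : V -> Prop) (I : Type) (r : seq I) (P : pred I)
    (F : I -> V) :
  (forall i, P i -> lspan G (F i)) -> lspan G (\sum_(i <- r | P i) F i).
Proof. by move=> GF; apply: big_ind => //; [apply: lspan0 | apply: lspanD]. Qed.

Lemma lspan_trans (V : lmodType K) (G H : V -> Prop) (x : V) :
  (forall y, G y -> lspan H y) -> lspan G x -> lspan H x.
Proof.
move=> GH; elim=> {x} [|x /GH //|x y _ Hx _ Hy|a x _ Hx].
- exact: lspan0.
- exact: lspanD.
exact: lspanZ.
Qed.

Lemma lspan_mul (V : algType K) (G H I : V -> Prop) (x y : V) :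
  (forall g h, G g -> H h -> lspan I (g * h)) ->
  lspan G x -> lspan H y -> lspan I (x * y).
Proof.
move=> GHI Gx Hy; elim: Gx => {x} [|x Gx|x x' _ Ix _ Ix'|a x _ Ix].
- by rewrite mul0r; apply: lspan0.
- elim: Hy => {y} [|y /(GHI _ _ Gx) //|y y' _ Iy _ Iy'|a y _ Iy].
  + by rewrite mulr0; apply: lspan0.
  + by rewrite mulrDr; apply: lspanD.
  by rewrite -scalerAr; apply: lspanZ.
- by rewrite mulrDl; apply: lspanD.
by rewrite -scalerAl; apply: lspanZ.
Qed.
End Span.

Definition qprod (s : seq nat) : Gamma rat := \prod_(b <- s) qfun b.

Definition sumsq (s : seq nat) : nat := \sum_(b <- s) b ^ 2.

(** A decreasing filtration of degree [N] by the sum of squares of the indices. It measures leading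
    terms; zero indices are harmless because q_0 = 1. *)
Definition qspan (N w : nat) : Gamma rat -> Prop :=
  lspan (fun x => exists s, [/\ x = qprod s, sumn s = N & (w <= sumsq s)%N]).

Lemma qspan_qprod (N w : nat) (s : seq nat) :
  sumn s = N -> (w <= sumsq s)%N -> qspan N w (qprod s).
Proof. by move=> sN ws; apply: lspan_gen; exists s. Qed.

Lemma qspan_qfun (r : nat) : qspan r (r ^ 2) (qfun r).
Proof.
have <- : qprod [:: r] = qfun r by rewrite /qprod big_seq1.
by apply: qspan_qprod; rewrite /= ?addn0 // /sumsq big_seq1.
Qed.

Lemma qspan1 : qspan 0 0 1.
Proof. by rewrite -qfun0; apply: (qspan_qfun 0). Qed.

Lemma qspan_mul (N N' w w' : nat) (x y : Gamma rat) :
  qspan N w x -> qspan N' w' y -> qspan (N + N') (w + w') (x * y).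
Proof.
apply: lspan_mul => _ _ [s [-> sN ws]] [s' [-> sN' ws']].
have -> : qprod s * qprod s' = qprod (s ++ s') by rewrite /qprod big_cat.
apply: qspan_qprod; first by rewrite sumn_cat sN sN'.
by rewrite /sumsq big_cat leq_add.
Qed.

Lemma qspan_le (N w w' : nat) (x : Gamma rat) :
  (w <= w')%N -> qspan N w' x -> qspan N w x.
Proof.
move=> ww; apply: lspan_trans => _ [s [-> sN ws]].
exact: qspan_qprod sN (leq_trans ww ws).
Qed.

Lemma qspan_qfun2 (a b w : nat) :
  (w <= a ^ 2 + b ^ 2)%N -> qspan (a + b) w (qfun a * qfun b).
Proof. by move=> ww; apply: qspan_le ww (qspan_mul _ _ _ _ _ _ _ _); apply: qspan_qfun. Qed.

(** Moving k > 0 units from the smaller index to the larger one strictly raises the sum of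
    squares. *)
Lemma qspan_Q2 (r s : nat) : (s <= r)%N ->
  qspan (r + s) (r ^ 2 + s ^ 2).+1 (Q2 r s - qfun r * qfun s).
Proof.
move=> sr; rewrite /Q2 addrAC subrr add0r mulr_natl -scaler_nat.
apply: lspanZ; rewrite big_nat; apply: lspan_sum => k /andP[k0 ks].
apply: lspan_sign; have -> : (r + s = (r + k) + (s - k))%N by lia.
by apply: qspan_qfun2; rewrite ltnS in ks; nia.
Qed.

(** The alternating relation in degree 2m is solved for its middle term; every other product has
    unequal indices and hence a larger sum of squares. *)
Lemma qspan_square (m : nat) : (0 < m)%N ->
  qspan (m + m) (m ^ 2 + m ^ 2).+1 (qfun m * qfun m).
Proof.
move=> m0; have := qfun_alternating_sum (m + m) ltac:(lia).
have mlt : (m < (m + m).+1)%N by lia.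
rewrite (bigD1 (Ordinal mlt)) //= addnK => /eqP; rewrite addr_eq0 => /eqP E.
have -> : qfun m * qfun m = (-1) ^+ m * ((-1) ^+ m * (qfun m * qfun m)).
  by rewrite mulrA -exprD addnn -signr_odd odd_double mul1r.
apply: lspan_sign; rewrite [X in lspan _ X]E; apply: lspanN; apply: lspan_sum => i im.
apply: lspan_sign; have ile := ltn_ord i.
have {}im : (i : nat) <> m by move=> E'; move/eqP: im; apply; apply: val_inj.
have ww : ((m ^ 2 + m ^ 2).+1 <= i ^ 2 + (m + m - i) ^ 2)%N by nia.
by have := qspan_qfun2 _ _ _ ww; rewrite subnKC.
Qed.

Lemma qspan_prod_sub (I : Type) (r : seq I) (P : pred I) (N w : I -> nat)
    (x y : I -> Gamma rat) :
  (forall i, P i -> qspan (N i) (w i) (y i)) ->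
  (forall i, P i -> qspan (N i) (w i).+1 (x i - y i)) ->
  qspan (\sum_(i <- r | P i) N i) (\sum_(i <- r | P i) w i).+1
    (\prod_(i <- r | P i) x i - \prod_(i <- r | P i) y i).
Proof.
move=> Hy Hxy.
suff [] : let n := (\sum_(i <- r | P i) N i)%N in let v := (\sum_(i <- r | P i) w i)%N in
  qspan n v (\prod_(i <- r | P i) y i) /\
  qspan n v.+1 (\prod_(i <- r | P i) x i - \prod_(i <- r | P i) y i) by [].
elim: r => [|i r [IHy IHxy]].
  by rewrite !big_nil subrr; split; [apply: qspan1 | apply: lspan0].
rewrite !big_cons; case: ifP => // Pi; split; first exact: qspan_mul (Hy i Pi) IHy.
set X := \prod_(j <- r | P j) x j in IHxy *; set Y := \prod_(j <- r | P j) y j in IHy IHxy *.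
(* Each summand has a factor [x i - y i] or [X - Y], which lies one step deeper in the
   filtration. *)
have -> : x i * X - y i * Y = (x i - y i) * (X - Y) + (x i - y i) * Y + y i * (X - Y) by ring.
apply: lspanD; first apply: lspanD.
- by apply: qspan_le (qspan_mul _ _ _ _ _ _ (Hxy i Pi) IHxy); lia.
- exact: qspan_mul (Hxy i Pi) IHy.
by apply: qspan_le (qspan_mul _ _ _ _ _ _ (Hy i Pi) IHxy); lia.
Qed.

(* Every perfect matching contributes a signed copy of the product of the
   [q_(lam i)] plus terms with a larger sum of squares; the signs add up to 1. *)
Lemma qspan_pfaffian (n : nat) (lam : nat -> nat) :
  ~~ odd n -> (forall i j, (i < j)%N -> (j < n)%N -> (lam j <= lam i)%N) ->
  qspan (\sum_(i < n) lam i) (\sum_(i < n) lam i ^ 2).+1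
    (pfaffian (\matrix_(i < n, j < n)
       if (i < j)%N then Q2 (lam i) (lam j)
       else if (j < i)%N then - Q2 (lam j) (lam i) else 0)
     - \prod_(i < n) qfun (lam i)).
Proof.
move=> even_n decr; have [m En] : exists m, n = m.*2 by exists n./2; lia.
subst n; set M := \matrix_(_, _) _.
pose e (i j : 'I_m.*2) : Gamma rat := ord_sign _ _ i j.
(* The leading part of [M]. Its permutation sum is that of the sign matrix times the product of all
   q_(lam i). *)
pose L (i j : 'I_m.*2) := e i j * (qfun (lam i) * qfun (lam j)).
have sumL : pfaffian_sum _ m.*2 L = (2 ^ m * m`!)%:R * \prod_(i < m.*2) qfun (lam i).
  rewrite -pfaffian_sum_ord_sign /pfaffian_sum big_distrl; apply: eq_bigr => s _ /=.
  rewrite /L big_split /= mulrA; congr (_ * _).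
  rewrite (big_even_pairs _ _ _ m (fun i => qfun (lam (s i)))).
  by rewrite [RHS](reindex_inj (@perm_inj _ s)).
have c0 : ((2 ^ m * m`!)%:R : rat) != 0.
  by rewrite Num.Theory.pnatr_eq0 muln_eq0 expn_eq0 /= -lt0n fact_gt0.
have -> : pfaffian M - \prod_(i < m.*2) qfun (lam i) =
    ((2 ^ m * m`!)%:R^-1 : rat) *: (pfaffian_sum _ m.*2 M - pfaffian_sum _ m.*2 L).
  rewrite scalerBr sumL mulr_natl -scaler_nat scalerA mulVf // scale1r.
  by rewrite /pfaffian doubleK.
apply: lspanZ; rewrite /pfaffian_sum -sumrB; apply: lspan_sum => s _.
rewrite -mulrBr; apply: lspan_sign.
(* Degree and sum of squares are regrouped along the pairs matched by [s], so the products can be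
   compared factor by factor. *)
have sumE (f : nat -> nat) : (\sum_(i < m.*2) f i =
    \sum_(i < m.*2 | ~~ odd i) (f (s i) + f (s (ordS i))))%N.
  rewrite (big_even_pairs _ _ _ m (fun i => f (s i))).
  by rewrite [LHS](reindex_inj (@perm_inj _ s)).
rewrite (sumE lam) (sumE (fun i => lam i ^ 2)%N).
apply: qspan_prod_sub => i _; move: (s i) (s (ordS i)) => {i} a b.
  rewrite /L /e /ord_sign; case: ifP => _; first by rewrite mul1r; apply: qspan_qfun2.
  case: ifP => _; last by rewrite mul0r; apply: lspan0.
  by rewrite mulN1r; apply: lspanN; apply: qspan_qfun2.
rewrite mxE /L /e /ord_sign; case: ifP => ab.
  by rewrite mul1r; apply: qspan_Q2; apply: decr.
case: ifP => ba; last by rewrite mul0r subrr; apply: lspan0.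
rewrite mulN1r opprK addrC -opprB [qfun (lam a) * _]mulrC; apply: lspanN.
by rewrite addnC [(lam a ^ 2 + _)%N]addnC; apply: qspan_Q2; apply: decr.
Qed.

(** * Spanning *)

Lemma qspan_Qfun (la : seq nat) :
  sorted gtn la -> qspan (sumn la) (sumsq la).+1 (Qfun la - qprod la).
Proof.
move=> la_sorted; rewrite /Qfun.
set l := if _ then _ else _.
have even_l : ~~ odd (size l).
  by rewrite /l; case: ifP => /= ol; rewrite ?size_rcons /= ol.
(* The padding zero agrees with the default value of [nth], and it changes neither the sums nor the
   product because q_0 = 1. *)
have nthl i : nth 0%N l i = nth 0%N la i.
  rewrite /l; case: ifP => // _; rewrite nth_rcons; case: ltngtP => // [la_i|->].
    by rewrite nth_default // ltnW.
  by rewrite nth_default.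
have sum_l (f : nat -> nat) : f 0%N = 0%N ->
    (\sum_(i < size l) f (nth 0 l i) = \sum_(b <- la) f b)%N.
  move=> f0; rewrite -[LHS](big_mkord xpredT (fun i => f (nth 0%N l i))) -(big_nth 0%N xpredT f).
  by rewrite /l; case: ifP => // _; rewrite -cats1 big_cat big_seq1 /= f0 addn0.
have prod_l : \prod_(i < size l) qfun (nth 0%N l i) = qprod la.
  rewrite -[LHS](big_mkord xpredT (fun i => qfun (nth 0%N l i))) -(big_nth 0%N xpredT qfun).
  rewrite /l /qprod; case: ifP => // _.
  by rewrite -cats1 big_cat big_seq1 /= qfun0 mulr1.
rewrite -prod_l sumnE -(sum_l id) // /sumsq -(sum_l (fun b => b ^ 2)%N) //.
apply: (qspan_pfaffian _ (nth 0%N l)) => // i j ij _; rewrite !nthl.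
case: (ltnP j (size la)) => [jla|?]; last by rewrite [X in (X <= _)%N]nth_default.
have tr : transitive gtn by move=> a b c /= ab /ltn_trans; apply.
by apply: ltnW; apply: (sorted_ltn_nth tr 0%N la_sorted); rewrite ?inE // (ltn_trans ij).
Qed.

Lemma not_uniq_perm (T : eqType) (s : seq T) :
  ~~ uniq s -> exists x s', perm_eq s [:: x, x & s'].
Proof.
elim: s => //= x s IH; rewrite negb_and negbK => /orP[xs|/IH [y [s' ss']]].
  by exists x, (rem x s); rewrite perm_cons perm_to_rem.
exists y, (x :: s'); apply: (@perm_trans _ (x :: [:: y, y & s'])).
  by rewrite perm_cons.
by rewrite (perm_catCA [:: x] [:: y; y] s').
Qed.

(** Bounds the sum of squares in a fixed degree, which makes downward induction on it possible. *)
Lemma sumsq_le (s : seq nat) : (sumsq s <= sumn s ^ 2)%N.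
Proof.
elim: s => [|b s IH]; first by rewrite /sumsq big_nil.
by rewrite /sumsq big_cons -/(sumsq s) /=; nia.
Qed.

Definition Qspan (N : nat) : Gamma rat -> Prop :=
  lspan (fun x => exists2 mu, mu \in SP N & x = Qfun mu).

(* Downward induction on the sum of squares of [s]. If [s] has distinct
   positive parts, then [qprod s] is [Qfun s] up to terms with a larger sum of
   squares; otherwise a repeated part can be eliminated. *)
Lemma Qspan_qprod (s : seq nat) : Qspan (sumn s) (qprod s).
Proof.
have [k] := ubnP (sumn s ^ 2 - sumsq s).
elim: k s => // k IH s sk.
pose u := sort geq [seq b <- s | (1 <= b)%N].
have us (R : Type) (idx : R) (op : Monoid.com_law idx) (F : nat -> R) :
    F 0%N = idx -> \big[op/idx]_(b <- u) F b = \big[op/idx]_(b <- s) F b.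
  move=> F0; rewrite (perm_big _ (permEl (perm_sort _ _))) big_filter big_mkcond.
  by apply: eq_bigr => -[|b].
have qu : qprod u = qprod s by apply: us; rewrite qfun0.
have nu : sumn u = sumn s by rewrite !sumnE; apply: us.
have wu : sumsq u = sumsq s by apply: us.
have u_gt0 b : b \in u -> (0 < b)%N by rewrite mem_sort mem_filter => /andP[].
(* The induction hypothesis, extended linearly to the next level of the filtration. *)
have higher x : qspan (sumn s) (sumsq s).+1 x -> Qspan (sumn s) x.
  apply: lspan_trans => _ [v [-> vs wv]]; rewrite -vs; apply: IH.
  by have := sumsq_le v; rewrite vs; lia.
rewrite -qu; case uniq_u : (uniq u).
  have su : sorted gtn u.
    rewrite gtn_sorted_uniq_geq uniq_u; apply: sort_sorted => a b.
    exact: leq_total.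
  have -> : qprod u = Qfun u - (Qfun u - qprod u) by rewrite subKr.
  apply: lspanB.
    apply: lspan_gen; exists u => //; rewrite mem_SP /is_strict_partition su nu eqxx.
    by rewrite andbT; apply/allP.
  by apply: higher; rewrite -nu -wu; apply: qspan_Qfun.
have [m [v uv]] := not_uniq_perm _ _ (negbT uniq_u).
have m_gt0 : (0 < m)%N by apply: u_gt0; rewrite (perm_mem uv) mem_head.
apply: higher; rewrite -nu -wu (perm_sumn uv) /sumsq /qprod !(perm_big _ uv).
rewrite !big_cons /= mulrA !addnA -addSn.
apply: qspan_mul; first exact: qspan_square.
exact: qspan_qprod.
Qed.

Lemma Qspan_qspan (N w : nat) (x : Gamma rat) : qspan N w x -> Qspan N x.
Proof. by apply: lspan_trans => _ [s [-> <- _]]; apply: Qspan_qprod. Qed.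

(** * Power-sum products and their relation to the q_r *)

Definition psum_prod (K : fieldType) (s : seq nat) : Gamma K := \prod_(k <- s) << ucm k >>.

(** The degree of [psum_prod K s], the index [k] standing for p_(2k+1). *)
Definition odd_weight (s : seq nat) : nat := \sum_(k <- s) k.*2.+1.

(** The recurrence for q_(2k+1) is solved for its last term 2 p_(2k+1) q_0; the other terms involve
    only smaller power sums. *)
Lemma qspan_ucm (k : nat) : qspan k.*2.+1 0 << ucm k >>.
Proof.
elim/ltn_ind: k => k IH.
have E : odd_psum rat k.*2 = 2 *: << ucm k >>.
  by rewrite /odd_psum odd_double /psum /= uphalf_double.
have := qfun_recl k.*2; rewrite big_ord_recr /= subnn qfun0 mulr1 E => R.
have -> : (<< ucm k >> : Gamma rat) = 2^-1 *: (2 *: << ucm k >>).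
  by rewrite scalerA mulVf ?scale1r.
apply: lspanZ; move/esym/eqP: R; rewrite addrC eq_sym -subr_eq eq_sym => /eqP ->.
apply: lspanB.
  rewrite mulr_natl -scaler_nat; apply: lspanZ.
  exact: qspan_le (qspan_qfun _).
apply: lspan_sum => i _; have ilt := ltn_ord i.
rewrite /odd_psum; case: ifP => oi; first by rewrite mul0r; apply: lspan0.
rewrite -scalerAl; apply: lspanZ.
have -> : k.*2.+1 = ((i./2).*2.+1 + (k.*2 - i))%N by lia.
rewrite -[0%N]/(0 + 0)%N; apply: qspan_mul; last exact: qspan_le (qspan_qfun _).
have -> : psum rat i.+1 = << ucm i./2 >>.
  by rewrite /psum -{1}(odd_double_half i) oi /= uphalf_double.
by apply: IH; lia.
Qed.

Lemma Qspan_psum_prod (s : seq nat) : Qspan (odd_weight s) (psum_prod rat s).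
Proof.
apply: (Qspan_qspan _ 0); rewrite /odd_weight /psum_prod.
elim: s => [|k s IH]; first by rewrite !big_nil; apply: qspan1.
by rewrite !big_cons; apply: (qspan_mul _ _ 0 0) IH; apply: qspan_ucm.
Qed.

Definition pspan (N : nat) : Gamma rat -> Prop :=
  lspan (fun x => exists2 s, odd_weight s = N & x = psum_prod rat s).

Lemma pspan_qfun (r : nat) : pspan r (qfun r).
Proof.
elim/ltn_ind: r => -[|r] IH.
  by rewrite qfun0; apply: lspan_gen; exists [::]; rewrite /odd_weight /psum_prod big_nil.
have r0 : (r.+1%:R : rat) != 0 by rewrite Num.Theory.pnatr_eq0.
have -> : qfun r.+1 = (r.+1%:R^-1 : rat) *: (r.+1%:R * qfun r.+1).
  by rewrite mulr_natl -scaler_nat scalerA mulVf // scale1r.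
apply: lspanZ; rewrite qfun_recl; apply: lspan_sum => k _; have klt := ltn_ord k.
rewrite /odd_psum; case: ifP => ok; first by rewrite mul0r; apply: lspan0.
rewrite -scalerAl; apply: lspanZ.
have rk : (r - k < r.+1)%N by rewrite ltnS leq_subr.
(* The left factor is treated as the span of the single generator p_(k+1). *)
apply: (lspan_mul _ _ (eq (psum rat k.+1))) (lspan_gen _ _ _ _ erefl) (IH _ rk).
move=> _ _ <- [s sw ->]; apply: lspan_gen; exists (k.+1./2 :: s).
  by rewrite /odd_weight big_cons -/(odd_weight s) sw; lia.
by rewrite /psum_prod big_cons.
Qed.

(** * Independence *)

Lemma binary_expansion_inj (R : nat) (b b' : nat -> bool) :
  (\sum_(a < R) b a * 2 ^ a = \sum_(a < R) b' a * 2 ^ a)%N ->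
  forall a, (a < R)%N -> b a = b' a.
Proof.
elim: R b b' => // R IH b b'.
have step (e : nat -> bool) : (\sum_(a < R.+1) e a * 2 ^ a =
    e 0 + (\sum_(a < R) e a.+1 * 2 ^ a).*2)%N.
  rewrite big_ord_recl expn0 muln1 -muln2 big_distrl; congr (_ + _)%N.
  by apply: eq_bigr => a _ /=; rewrite expnSr mulnA.
rewrite !step => E.
have E0 : b 0%N = b' 0%N.
  by have := congr1 odd E; rewrite !oddD !odd_double !addbF; case: (b _); case: (b' _).
case=> // a aR; apply: (IH (fun a => b a.+1) (fun a => b' a.+1)) => //.
by move: E; rewrite E0 => /addnI /double_inj.
Qed.

(* Glaisher's map sends a part [2^a (2k+1)] to [2^a] parts [2k+1]; the part
   [2k+1] is encoded by [k]. *)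
Definition glaisher_part (b : nat) : seq nat :=
  nseq (2 ^ logn 2 b) (b %/ 2 ^ logn 2 b)./2.

Definition glaisher (mu : seq nat) : seq nat := flatten [seq glaisher_part b | b <- mu].

Lemma odd_part (b : nat) : (0 < b)%N ->
  (b = 2 ^ logn 2 b * (b %/ 2 ^ logn 2 b)./2.*2.+1)%N.
Proof.
move=> b0; have [c oc bE] := @pfactor_coprime 2 b isT b0.
rewrite coprime2n in oc; rewrite {3}bE mulnK ?expn_gt0 //.
by have := odd_double_half c; rewrite oc add1n => ->; rewrite mulnC.
Qed.

Lemma odd_weight_glaisher (mu : seq nat) :
  all (leq 1) mu -> odd_weight (glaisher mu) = sumn mu.
Proof.
rewrite /odd_weight /glaisher; elim: mu => [|b mu IH] /=; first by rewrite big_nil.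
case/andP=> b0 /IH IHmu; rewrite big_cat IHmu /=; congr (_ + _)%N.
by rewrite [RHS](odd_part b) // big_nseq iter_addn_0 mulnC.
Qed.

(** The multiplicity of the part 2k+1 has binary digits telling which 2^a (2k+1) are parts of [mu];
    distinctness of the parts makes these digits 0 or 1. *)
Lemma count_glaisher (k R : nat) (mu : seq nat) :
  all (leq 1) mu -> uniq mu -> (sumn mu <= R)%N ->
  (count_mem k (glaisher mu) =
   \sum_(a < R) (2 ^ a * k.*2.+1 \in mu)%N * 2 ^ a)%N.
Proof.
move=> mu0 uniq_mu muR.
have -> : (\sum_(a < R) (2 ^ a * k.*2.+1 \in mu)%N * 2 ^ a =
    \sum_(b <- mu) \sum_(a < R) (b == 2 ^ a * k.*2.+1)%N * 2 ^ a)%N.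
  rewrite exchange_big; apply: eq_bigr => a _ /=; rewrite -big_distrl /=.
  by rewrite -count_uniq_mem // -sum1_count big_mkcond.
rewrite /glaisher {uniq_mu}; elim: mu mu0 muR => [|b mu IH] /=; first by rewrite big_nil.
case/andP=> b0 mu0 muR; rewrite count_cat big_cons IH //; last by lia.
congr (_ + _)%N; rewrite count_nseq /=.
have ltR : (logn 2 b < R)%N.
  by apply: leq_trans (ltn_logl 2 b0) _; lia.
have logE a : (logn 2 (2 ^ a * k.*2.+1) = a)%N.
  rewrite lognM ?expn_gt0 // pfactorK // logn_coprime ?addn0 //.
  by rewrite coprime2n /= odd_double.
case: eqP => [kE|kN]; last first.
  rewrite big1 // => a _; case: eqP => // bE; case: kN.
  by rewrite {1}bE bE logE mulKn ?expn_gt0 //= uphalf_double.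
rewrite (bigD1 (Ordinal ltR)) //= -kE -odd_part // eqxx big1 ?addn0 // => a /eqP aN.
case: eqP => // bE; case: aN; apply: val_inj => /=.
by rewrite bE kE logE.
Qed.

Lemma glaisher_inj (N : nat) (mu nu : seq nat) :
  mu \in SP N -> nu \in SP N ->
  (forall k, count_mem k (glaisher mu) = count_mem k (glaisher nu)) -> mu = nu.
Proof.
rewrite !mem_SP => /and3P[smu mu0 /eqP muN] /and3P[snu nu0 /eqP nuN] E.
have tr : transitive gtn by move=> a b c /= ab /ltn_trans; apply.
have irr : irreflexive gtn by move=> a /=; rewrite ltnn.
have umu := sorted_uniq tr irr smu; have unu := sorted_uniq tr irr snu.
apply: (irr_sorted_eq tr irr smu snu) => b.
have [->|b0] := posnP b.
  by apply/idP/idP => [/(allP mu0)|/(allP nu0)].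
have := E (b %/ 2 ^ logn 2 b)./2.
(* The digit bound must dominate both sums and the position [logn 2 b] at which the digit is
   read. *)
rewrite (count_glaisher _ (maxn N b)) ?muN ?leq_maxl //.
rewrite (count_glaisher _ (maxn N b)) ?nuN ?leq_maxl //.
pose e (la : seq nat) a := (2 ^ a * (b %/ 2 ^ logn 2 b)./2.*2.+1)%N \in la.
move/(binary_expansion_inj _ (e mu) (e nu))/(_ (logn 2 b)).
rewrite /e -odd_part //; apply.
by apply: leq_trans (ltn_logl 2 b0) (leq_maxr _ _).
Qed.

Definition pmonom (s : seq nat) : {cmonom nat} := \big[mmul/mone]_(k <- s) ucm k.

Lemma pmonomE (s : seq nat) (k : nat) : pmonom s k = count_mem k s.
Proof.
rewrite /pmonom; elim: s => [|i s IH]; first by rewrite big_nil cm1.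
by rewrite big_cons cmM cmU IH.
Qed.

Lemma monomial_mul (K : fieldType) (m1 m2 : {cmonom nat}) :
  << m1 >> * << m2 >> = << mmul m1 m2 >> :> Gamma K.
Proof. by rewrite malgM_def fgmulUU mulr1. Qed.

Lemma psum_prodE (K : fieldType) (s : seq nat) : psum_prod K s = << pmonom s >>.
Proof.
rewrite /psum_prod /pmonom; elim: s => [|i s IH]; first by rewrite !big_nil.
rewrite big_cons IH [in RHS]big_cons; exact: monomial_mul.
Qed.

Lemma lspan_seqP (K : fieldType) (V : lmodType K) (T : eqType) (r : seq T) (F : T -> V)
    (x : V) :
  uniq r -> lspan (fun y => exists2 i, i \in r & y = F i) x ->
  exists c : T -> K, x = \sum_(i <- r) c i *: F i.
Proof.
move=> uniq_r; elim=> {x} [|x [i ir ->]|x y _ [c ->] _ [c' ->]|a x _ [c ->]].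
- by exists (fun=> 0); rewrite big1 // => i _; rewrite scale0r.
- exists (fun j => (j == i)%:R); rewrite (bigD1_seq i) //= eqxx scale1r big1 ?addr0 //.
  by move=> j /negbTE ->; rewrite scale0r.
- exists (fun i => c i + c' i); rewrite -big_split; apply: eq_bigr => i _.
  by rewrite scalerDl.
exists (fun i => a * c i); rewrite scaler_sumr; apply: eq_bigr => i _.
by rewrite scalerA.
Qed.

Section Basis.
Variables (K : fieldType) (iota : {rmorphism rat -> K}).

Lemma ucm_psum (L : fieldType) (k : nat) : << ucm k >> = psum L k.*2.+1.
Proof. by rewrite /psum /= uphalf_double. Qed.

Lemma ext_psum_prod (s : seq nat) : ext iota (psum_prod rat s) = psum_prod K s.
Proof.
rewrite /psum_prod rmorph_prod; apply: eq_bigr => k _.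
by rewrite ucm_psum /ext odd_subst_psum ?ucm_psum //= odd_double.
Qed.

Lemma psum_prod_Q_expansion (s : seq nat) :
  exists c : seq nat -> rat,
    psum_prod K s = \sum_(mu <- SP (odd_weight s)) iota (c mu) *: ext iota (Qfun mu).
Proof.
have [c E] := lspan_seqP _ _ _ _ _ _ (SP_uniq _) (Qspan_psum_prod s).
exists c; rewrite -ext_psum_prod {1}E rmorph_sum; apply: eq_bigr => mu _.
exact: odd_substZ.
Qed.

(* The Glaisher monomials of the strict partitions of [N] are distinct and lie
   in the span of the equally many [ext iota (Qfun mu)]. *)
Lemma ext_Qfun_free (N : nat) (c : seq nat -> K) :
  \sum_(mu <- SP N) c mu *: ext iota (Qfun mu) = 0 ->
  forall mu, mu \in SP N -> c mu = 0.
Proof.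
move=> c_rel; set d := size (SP N); pose la (i : 'I_d) := nth [::] (SP N) i.
have la_SP i : la i \in SP N by apply: mem_nth.
have sumE (F : seq nat -> Gamma K) : \sum_(mu <- SP N) F mu = \sum_i F (la i).
  by rewrite (big_nth [::]) big_mkord.
pose g i := pmonom (glaisher (la i)).
have g_inj : injective g.
  move=> i j gij; apply/val_inj/eqP; rewrite -(nth_uniq [::] (ltn_ord i) (ltn_ord j) (SP_uniq N)).
  apply/eqP; apply: (glaisher_inj N (la i) (la j) (la_SP i) (la_SP j)) => k.
  by rewrite -!pmonomE -/(g i) -/(g j) gij.
have [B BE] : exists B : 'I_d -> seq nat -> K, forall i,
    << g i >> = \sum_(mu <- SP N) B i mu *: ext iota (Qfun mu).
  apply: (fin_all_exists (U := fun=> seq nat -> K) (P := fun j b =>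
    << g j >> = \sum_(mu <- SP N) b mu *: ext iota (Qfun mu))) => i.
  have [b bE] := psum_prod_Q_expansion (glaisher (la i)).
  exists (fun mu => iota (b mu)); rewrite -psum_prodE bE odd_weight_glaisher.
    by have := la_SP i; rewrite mem_SP => /and3P[_ _ /eqP ->].
  by have := la_SP i; rewrite mem_SP => /and3P[].
(* [A] holds the coefficients of the Q-functions at the Glaisher monomials, and [B'] expresses these
   monomials in the Q-functions. Both are square, so the left inverse [B'] is also a right
   inverse. *)
pose A := \matrix_(i, j) (ext iota (Qfun (la i)))@_(g j).
pose B' := \matrix_(i, j) B i (la j).
have coefE (u : seq nat -> K) (j : 'I_d) :
    (\sum_(mu <- SP N) u mu *: ext iota (Qfun mu))@_(g j) =
    ((\row_i u (la i)) *m A) ord0 j.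
  rewrite sumE raddf_sum mxE; apply: eq_bigr => i _.
  by rewrite /= mcoeffZ !mxE.
have BA : B' *m A = 1%:M.
  apply/matrixP => i j; rewrite [RHS]mxE -(inj_eq g_inj) -mcoeffU1 BE coefE !mxE.
  by apply: eq_bigr => k _; rewrite !mxE.
have c0 : (\row_i c (la i)) = 0.
  rewrite -[LHS]mulmx1 -(mulmx1C BA) mulmxA.
  suff -> : (\row_i c (la i)) *m A = 0 by rewrite mul0mx.
  by apply/rowP => j; rewrite -coefE c_rel mcoeff0 mxE.
move=> mu muN; have mu_lt : (index mu (SP N) < d)%N by rewrite index_mem.
have := congr1 (fun v : 'rV_d => v ord0 (Ordinal mu_lt)) c0.
by rewrite !mxE /la /= nth_index.
Qed.

Lemma Q_expansion_unique (N : nat) (f : Gamma K) (c c' : seq nat -> K) :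
  is_Q_expansion iota N f c -> is_Q_expansion iota N f c' ->
  forall mu, mu \in SP N -> c mu = c' mu.
Proof.
move=> fc fc' mu muN; apply/eqP; rewrite -subr_eq0; apply/eqP.
apply: (ext_Qfun_free N (fun mu => c mu - c' mu)) mu muN.
under eq_bigr do rewrite scalerBl.
by rewrite sumrB; apply/eqP; rewrite subr_eq0 -[X in X == _]fc; apply/eqP.
Qed.
End Basis.

(** * Specialization at (t^2, t) *)

Section ValueAt.

Definition specialize : {rmorphism {poly {poly rat}} -> {poly rat}} :=
  horner_eval ('X : {poly rat}) \o map_poly (comp_poly ('X^2 : {poly rat})).

Lemma poly_at_t2_tE (P : {poly {poly rat}}) : poly_at_t2_t P = specialize P.
Proof. by []. Qed.

Let tofrac_ts := (@FracField.tofrac {poly {poly rat}}).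
Let tofrac_t := (@FracField.tofrac {poly rat}).

Lemma is_value_specialize (P : {poly {poly rat}}) :
  is_value_at_t2_t (tofrac_ts P) (tofrac_t (specialize P)).
Proof.
exists P, 1; rewrite !poly_at_t2_tE rmorph1 oner_neq0.
by split=> //; rewrite rmorph1 divr1.
Qed.

Lemma is_value_iota (x : rat) : is_value_at_t2_t (iota_ts x) (iota_t x).
Proof.
have := is_value_specialize (x%:P)%:P.
by rewrite /specialize /= map_polyC /= /horner_eval hornerC comp_polyC.
Qed.

Lemma is_value_t : is_value_at_t2_t t_ts (t_t ^+ 2).
Proof.
have := is_value_specialize ('X)%:P.
by rewrite /specialize /= map_polyC /= /horner_eval hornerC comp_polyX /tofrac_t rmorphXn.
Qed.

Lemma is_value_s : is_value_at_t2_t s_ts t_t.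
Proof.
have := is_value_specialize 'X.
by rewrite /specialize /= map_polyX /horner_eval hornerX.
Qed.

Lemma is_value_nz (b : {poly {poly rat}}) :
  specialize b != 0 -> tofrac_ts b != 0 /\ tofrac_t (specialize b) != 0.
Proof.
move=> b0; rewrite /tofrac_ts /tofrac_t !tofrac_eq0; split=> //.
by apply: contraNneq b0 => ->; rewrite rmorph0.
Qed.

Lemma is_valueD (f f' : Qts) (g g' : Qt) :
  is_value_at_t2_t f g -> is_value_at_t2_t f' g' -> is_value_at_t2_t (f + f') (g + g').
Proof.
case=> a [b []]; rewrite !poly_at_t2_tE => b0 -> ->.
case=> a' [b' []]; rewrite !poly_at_t2_tE => b0' -> ->.
have [nb mb] := is_value_nz _ b0; have [nb' mb'] := is_value_nz _ b0'.
exists (a * b' + a' * b), (b * b'); rewrite !poly_at_t2_tE; split.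
- by rewrite (rmorphM specialize) mulf_neq0.
- by rewrite (addf_div _ _ nb nb') tofracD !tofracM.
by rewrite (addf_div _ _ mb mb') (rmorphD specialize) !(rmorphM specialize) tofracD !tofracM.
Qed.

Lemma is_valueM (f f' : Qts) (g g' : Qt) :
  is_value_at_t2_t f g -> is_value_at_t2_t f' g' -> is_value_at_t2_t (f * f') (g * g').
Proof.
case=> a [b []]; rewrite !poly_at_t2_tE => b0 -> ->.
case=> a' [b' []]; rewrite !poly_at_t2_tE => b0' -> ->.
exists (a * a'), (b * b'); rewrite !poly_at_t2_tE; split.
- by rewrite (rmorphM specialize) mulf_neq0.
- by rewrite mulf_div !tofracM.
by rewrite mulf_div !(rmorphM specialize) !tofracM.
Qed.

(** A nonzero value means that the numerator survives specialization and may serve as a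
    denominator. *)
Lemma is_valueV (f : Qts) (g : Qt) :
  g != 0 -> is_value_at_t2_t f g -> is_value_at_t2_t f^-1 g^-1.
Proof.
move=> g0 [a [b []]]; rewrite !poly_at_t2_tE => b0 -> gE; exists b, a.
rewrite !poly_at_t2_tE gE !invf_div; split=> //.
by apply: contraNneq g0; rewrite gE => ->; rewrite rmorph0 mul0r.
Qed.

Lemma is_value_nat (m : nat) : is_value_at_t2_t m%:R m%:R.
Proof. by have := is_value_iota m%:R; rewrite !rmorph_nat. Qed.

Lemma is_valueN (f : Qts) (g : Qt) :
  is_value_at_t2_t f g -> is_value_at_t2_t (- f) (- g).
Proof.
have := is_value_iota (-1); rewrite !rmorphN1 => v1 v.
by rewrite -mulN1r -(mulN1r g); apply: is_valueM.
Qed.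

Lemma is_valueX (f : Qts) (g : Qt) (n : nat) :
  is_value_at_t2_t f g -> is_value_at_t2_t (f ^+ n) (g ^+ n).
Proof.
move=> v; elim: n => [|n IH]; first exact: (is_value_nat 1).
by rewrite !exprS; apply: is_valueM.
Qed.

Lemma is_value_unique (f : Qts) (g g' : Qt) :
  is_value_at_t2_t f g -> is_value_at_t2_t f g' -> g = g'.
Proof.
case=> a [b []]; rewrite !poly_at_t2_tE => b0 -> ->.
case=> a' [b' []]; rewrite !poly_at_t2_tE => b0' E ->.
have [nb mb] := is_value_nz _ b0; have [nb' mb'] := is_value_nz _ b0'.
move/eqP: E; rewrite (eqr_div _ _ nb nb') -!tofracM tofrac_eq => /eqP E.
by apply/eqP; rewrite (eqr_div _ _ mb mb') -!tofracM -!(rmorphM specialize) E.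
Qed.

(** The value is picked by [epsilon]; uniqueness identifies it with any value exhibited. *)
Lemma value_at_t2_tE (f : Qts) (g : Qt) : is_value_at_t2_t f g -> value_at_t2_t f = g.
Proof.
move=> v; apply: (is_value_unique f _ g _ v).
exact: (epsilon_spec _ _ (ex_intro (is_value_at_t2_t f) g v)).
Qed.

Lemma t_pow_neq1 (n : nat) : (0 < n)%N -> 1 - t_t ^+ n != 0.
Proof.
move=> n0; rewrite /t_t -rmorphXn -(rmorph1 (@FracField.tofrac {poly rat})) -rmorphB.
rewrite tofrac_eq0 subr_eq0 eq_sym; apply: contraTneq n0 => E.
have := congr1 (fun p : {poly rat} => size p) E; rewrite size_polyXn size_poly1.
by case=> ->.
Qed.

(** Because (1 - t^(2n)) / (1 - t^n) = 1 + t^n, the scaling factors of [T_ts] specialize to those of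
    the plethysm. *)
Lemma is_value_scale (n : nat) : (0 < n)%N ->
  is_value_at_t2_t ((1 - t_ts ^+ n) / (1 - s_ts ^+ n)) (1 + t_t ^+ n).
Proof.
move=> n0; have nz := t_pow_neq1 n n0.
have -> : 1 + t_t ^+ n = (1 - (t_t ^+ 2) ^+ n) / (1 - t_t ^+ n).
  by rewrite exprAC -[X in X - _](expr1n _ 2) subr_sqr mulrC (mulKf nz).
apply: is_valueM; last apply: is_valueV => //.
  by apply: is_valueD (is_value_nat 1) (is_valueN _ _ (is_valueX _ _ _ is_value_t)).
by apply: is_valueD (is_value_nat 1) (is_valueN _ _ (is_valueX _ _ _ is_value_s)).
Qed.
End ValueAt.

(** * Parallel expansions over two coefficient fields *)

Lemma scalerMM (K : fieldType) (V : algType K) (a b : K) (x y : V) :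
  (a *: x) * (b *: y) = (a * b) *: (x * y).
Proof. by rewrite -scalerAl -scalerAr scalerA. Qed.

Lemma rescale_psum_prod (K : fieldType) (c : nat -> K) (s : seq nat) :
  rescale c (psum_prod K s) = (\prod_(k <- s) c k.*2.+1) *: psum_prod K s.
Proof.
elim: s => [|k s IH]; first by rewrite /psum_prod !big_nil rmorph1 scale1r.
rewrite /psum_prod !big_cons -/(psum_prod K s) rmorphM IH ucm_psum.
have o : odd k.*2.+1 by rewrite /= odd_double.
rewrite /rescale (odd_subst_psum _ _ _ _ _ o).
exact: scalerMM.
Qed.

Section Expansion.
Variables (K : fieldType) (iota : {rmorphism rat -> K}) (N : nat).

Lemma Q_expansionD (f g : Gamma K) (c d : seq nat -> K) :
  is_Q_expansion iota N f c -> is_Q_expansion iota N g d ->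
  is_Q_expansion iota N (f + g) (fun mu => c mu + d mu).
Proof.
rewrite /is_Q_expansion => -> ->; rewrite -big_split; apply: eq_bigr => mu _.
by rewrite scalerDl.
Qed.

Lemma Q_expansionZ (f : Gamma K) (a : K) (c : seq nat -> K) :
  is_Q_expansion iota N f c -> is_Q_expansion iota N (a *: f) (fun mu => a * c mu).
Proof.
rewrite /is_Q_expansion => ->; rewrite scaler_sumr; apply: eq_bigr => mu _.
by rewrite scalerA.
Qed.
End Expansion.

(** Power-sum products are eigenvectors of [rescale] and have rational Q-expansions. Both expansions
    are thus built from the same rational data, and [r], being compatible with sums and products,
    relates their coefficients. *)
Lemma rescaled_expansions (K L : fieldType) (iota : {rmorphism rat -> K})
    (kappa : {rmorphism rat -> L}) (a : nat -> K) (b : nat -> L) (r : K -> L -> Prop)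
    (N : nat) (f : Gamma rat) :
  (forall x, r (iota x) (kappa x)) ->
  (forall x x' y y', r x y -> r x' y' -> r (x + x') (y + y')) ->
  (forall x x' y y', r x y -> r x' y' -> r (x * x') (y * y')) ->
  (forall n, (0 < n)%N -> r (a n) (b n)) ->
  pspan N f ->
  exists (c : seq nat -> K) (d : seq nat -> L),
  [/\ forall mu, r (c mu) (d mu),
      is_Q_expansion iota N (rescale a (ext iota f)) c
    & is_Q_expansion kappa N (rescale b (ext kappa f)) d].
Proof.
move=> r_rat rD rM rab.
elim=> {f} [|f [s sN ->]|f g _ [c [d [cd Ec Ed]]] _ [c' [d' [cd' Ec' Ed']]]
           |x f _ [c [d [cd Ec Ed]]]].
- exists (fun=> iota 0), (fun=> kappa 0); split=> [mu||]; first exact: r_rat.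
    by rewrite /is_Q_expansion !rmorph0 big1 // => mu _; rewrite scale0r.
  by rewrite /is_Q_expansion !rmorph0 big1 // => mu _; rewrite scale0r.
- have [u uE] : exists u : seq nat -> rat,
      psum_prod rat s = \sum_(mu <- SP N) u mu *: Qfun mu.
    by rewrite -sN; apply: lspan_seqP (SP_uniq _) (Qspan_psum_prod s).
  have extE (F : fieldType) (phi : {rmorphism rat -> F}) (v : nat -> F) :
      is_Q_expansion phi N (rescale v (ext phi (psum_prod rat s)))
        (fun mu => (\prod_(k <- s) v k.*2.+1) * phi (u mu)).
    rewrite /is_Q_expansion ext_psum_prod rescale_psum_prod -(ext_psum_prod F phi) uE.
    rewrite rmorph_sum scaler_sumr; apply: eq_bigr => mu _.
    by rewrite -scalerA; congr (_ *: _); apply: odd_substZ.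
  exists (fun mu => (\prod_(k <- s) a k.*2.+1) * iota (u mu)).
  exists (fun mu => (\prod_(k <- s) b k.*2.+1) * kappa (u mu)).
  split=> [mu||]; [|exact: extE|exact: extE].
  apply: (rM) => //; apply: (big_ind2 r) => [||k _]; last exact: rab.
    by have := r_rat 1; rewrite !rmorph1.
  by move=> *; apply: rM.
- exists (fun mu => c mu + c' mu), (fun mu => d mu + d' mu); split=> [mu||].
  + exact: rD.
  + by rewrite !rmorphD; apply: Q_expansionD.
  by rewrite !rmorphD; apply: Q_expansionD.
exists (fun mu => iota x * c mu), (fun mu => kappa x * d mu); split=> [mu||].
- exact: rM.
- rewrite (odd_substZ _ _ _ _ x f) (odd_substZ _ _ _ _ (iota x)).
  exact (Q_expansionZ _ _ _ _ (iota x) _ Ec).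
rewrite (odd_substZ _ _ _ _ x f) (odd_substZ _ _ _ _ (kappa x)).
exact (Q_expansionZ _ _ _ _ (kappa x) _ Ed).
Qed.

Lemma plethysm_expansion (N : nat) (f : Gamma rat) : pspan N f ->
  exists (c : seq nat -> Qts) (c' : seq nat -> Qt),
  [/\ forall mu, is_value_at_t2_t (c mu) (c' mu),
      is_Q_expansion iota_ts N (T_ts (ext iota_ts f)) c
    & is_Q_expansion iota_t N (plethysm_1_plus_t f) c'].
Proof.
apply: rescaled_expansions is_value_iota _ _ is_value_scale => *.
  exact: is_valueD.
exact: is_valueM.
Qed.

(** Uniqueness of Q-expansions is used twice: over [Qts] for the coefficients chosen by [epsilon],
    and over [Qt] for their specializations. *)
Lemma C2_one_row (n : nat) (c : seq nat -> Qt) :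
  is_Q_expansion iota_t n (plethysm_1_plus_t (Qfun [:: n])) c ->
  forall mu, mu \in SP n -> C2 [:: n] mu = c mu.
Proof.
move=> nc mu muN; have [d [d' [v E E']]] := plethysm_expansion n _ (pspan_qfun n).
rewrite -Qfun_one_part in E E'.
rewrite -(Q_expansion_unique _ _ _ _ _ _ E' nc _ muN).
apply: value_at_t2_tE; suff -> : C [:: n] mu = d mu by apply: v.
have sn : sumn [:: n] = n by rewrite /= addn0.
apply: (Q_expansion_unique _ _ _ _ _ _ _ E _ muN); rewrite -{1}sn.
(* The expansion [d] witnesses the existence that [epsilon] requires. *)
by apply: (epsilon_spec (inhabits (fun=> 0)));  exists d; rewrite sn.
Qed.

(** * Two-row partitions and the final coefficients *)

Lemma two_row_SP (n j : nat) : (j.*2 < n)%N -> two_row n j \in SP n.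
Proof.
move=> jn; rewrite mem_SP /is_strict_partition /two_row.
by case: eqP => j0 /=; rewrite ?addn0; lia.
Qed.

Lemma two_row_inj (n i j : nat) :
  (i.*2 < n)%N -> (j.*2 < n)%N -> two_row n i = two_row n j -> i = j.
Proof. by move=> _ _; rewrite /two_row; case: eqP => [->|_]; case: eqP => [->|_] // [_]. Qed.

Theorem theorem5p2 (n : nat) (hn : (1 <= n)%N) :
  [/\ (forall j : nat, (j.*2 < n)%N ->
         C2 [:: n] (two_row n j) = t_t ^+ j * (1 + t_t) * qint (n - j.*2)),
      (forall mu : seq nat, mu \in SP n -> (2 < size mu)%N -> C2 [:: n] mu = 0)
    & plethysm_1_plus_t (Qfun [:: n]) =
        \sum_(j < n | (j.*2 < n)%N)
          (t_t ^+ j * (1 + t_t) * qint (n - j.*2)) *: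
            ext iota_t (Qfun (two_row n j))].
Proof.
have P := plethysm_one_row n hn.
pose d j := t_t ^+ j * (1 + t_t) * qint (n - j.*2).
(* Extends the two-row coefficients to all [mu]: the sum has at most one term, and none when [mu] is
   not a two-row partition. *)
pose c mu : Qt := \sum_(j < n | (j.*2 < n)%N && (two_row n j == mu)) d j.
have cP : is_Q_expansion iota_t n (plethysm_1_plus_t (Qfun [:: n])) c.
  rewrite /is_Q_expansion P.
  under [RHS]eq_bigr => mu _ do rewrite /c scaler_suml big_mkcondr.
  (* For each [j] exactly one [mu] in [SP n] contributes, namely [two_row n j]. *)
  rewrite exchange_big; apply: eq_bigr => j jn /=.
  rewrite (bigD1_seq (two_row n j)) ?two_row_SP ?SP_uniq //= eqxx big1 ?addr0 //.
  by move=> mu /negbTE; rewrite eq_sym => ->.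
split=> // [j jn|mu muN mu2].
  rewrite (C2_one_row _ _ cP) ?two_row_SP // /c.
  have jlt : (j < n)%N by lia.
  rewrite (big_pred1 (Ordinal jlt)) // => i /=; apply/andP/eqP => [[iN /eqP E]|->].
    by apply: val_inj; apply: (two_row_inj n).
  by rewrite eqxx.
rewrite (C2_one_row _ _ cP) // /c big_pred0 // => j; apply/negbTE/negP.
case/andP=> _ /eqP E; move: mu2; rewrite -E /two_row.
by case: eqP.
Qed.
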